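(* Let $(Z,d_Z)$ be a separable metric space and $p\in[1,\infty]$. Then the metric space $(\mathcal{M}_\sim^{Z,p},\mathrm{GW}_p^Z)$ is complete if and only if $(Z,d_Z)$ is complete.
   Context: A $(Z,p)$-network is a triple $(X,\omega_X,\mu_X)$ where $X$ is a Polish space, $\mu_X$ is a Borel probability measure on $X$, and $\omega_X:X\times X\to Z$ is measurable with $\|d_Z(\omega_X(\cdot,\cdot),z_0)\|_{L^p(\mu_X\otimes\mu_X)}<\infty$ for some (equivalently every) $z_0\in Z$. $\mathcal{C}(\mu_X,\mu_Y)$ is the set of probability measures on $X\times Y$ with marginals $\mu_X$ and $\mu_Y$. Define $$\mathrm{GW}_p^Z(X,Y)=\tfrac12\inf_{\pi\in\mathcal{C}(\mu_X,\mu_Y)}\big\|(x,y,x',y')\mapsto d_Z(\omega_X(x,x'),\omega_Y(y,y'))\big\|_{L^p(\pi\otimes\pi)}$$ (essential supremum if $p=\infty$). $(Z,p)$-networks $X$ and $Y$ are weakly isomorphic, $X\sim Y$, if there exist a $(Z,p)$-network $(W,\omega_W,\mu_W)$ and measurable maps $\phi_X:W\to X$, $\phi_Y:W\to Y$ with $(\phi_X)_*\mu_W=\mu_X$, $(\phi_Y)_*\mu_W=\mu_Y$ and $\omega_W(w,w')=\omega_X(\phi_X(w),\phi_X(w'))=\omega_Y(\phi_Y(w),\phi_Y(w'))$ for $\mu_W\otimes\mu_W$-almost every $(w,w')$. $\mathcal{M}_\sim^{Z,p}$ is the quotient of the collection of all $(Z,p)$-networks by $\sim$; $\mathrm{GW}_p^Z$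 is a metric on it. *)

(* Defs.v *)
From HB Require Import structures.
From mathcomp Require Import all_boot all_order all_algebra.
From mathcomp Require Import all_classical all_reals all_analysis.

Set Implicit Arguments.
Unset Strict Implicit.
Unset Printing Implicit Defensive.

Import Order.TTheory GRing.Theory Num.Theory.

Local Open Scope classical_set_scope.
Local Open Scope ring_scope.
Local Open Scope ereal_scope.

Definition separable (T : topologicalType) : Prop :=
  exists2 D : set T, countable D & dense D.

(* Completeness of a distance function: every Cauchy sequence converges. The
   distance takes values in \bar R so that the same notion applies to mdist
   and to the Gromov-Wasserstein distance. *)
Definition complete_dist (R : realType) (T : Type) (d : T -> T -> \bar R) :
    Prop :=
  forall u : nat -> T,
    (forall e : R, (0 < e)%R -> exists N : nat,
       forall m n : nat, (N <= m)%N -> (N <= n)%N -> d (u m) (u n) < e%:E) ->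
    exists l : T, forall e : R, (0 < e)%R -> exists N : nat,
      forall n : nat, (N <= n)%N -> d (u n) l < e%:E.

Definition complete_metric (R : realType) (M : metricType R) : Prop :=
  complete_dist (fun x y : M => (mdist x y)%:E).

Definition homeomorphic (T U : topologicalType) : Prop :=
  exists f : T -> U, exists g : U -> T,
    [/\ continuous f, continuous g, cancel f g & cancel g f].

Definition completely_metrizable (R : realType) (T : topologicalType) : Prop :=
  exists M : metricType R, complete_metric M /\ homeomorphic T M.

Definition polish (R : realType) (T : topologicalType) : Prop :=
  separable T /\ completely_metrizable R T.

Notation borel T := (g_sigma_algebraType (@open T)).

(* Measurability into a topological space with its Borel sigma-algebra; the
   codomain may be empty, hence is not assumed to be a measurableType (which
   is pointed). *)
Definition borel_measurable d (T : measurableType d) (Z : topologicalType)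
    (f : T -> Z) : Prop :=
  forall B : set Z, <<s (@open Z)>> B -> measurable (f @^-1` B).

(* The pointed structure on the carrier is harmless: a space carrying a
   probability measure is nonempty. The domain of ntw_omega has the product
   sigma-algebra, which for Polish spaces is the Borel one. *)
Record network (R : realType) (Z : metricType R) (p : \bar R) := Network {
  ntw_carrier :> ptopologicalType ;
  ntw_polish : polish R ntw_carrier ;
  ntw_mu : probability (borel ntw_carrier) R ;
  ntw_omega : borel ntw_carrier * borel ntw_carrier -> Z ;
  ntw_measurable : borel_measurable ntw_omega ;
  ntw_finite : exists z0 : Z,
    'N[ntw_mu \x ntw_mu]_p[(fun x => (mdist (ntw_omega x) z0)%:E)] < +oo
}.

Section gromov_wasserstein.
Variables (R : realType) (Z : metricType R) (p : \bar R).
Implicit Types X Y : network Z p.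

Definition coupling X Y : set (probability (borel X * borel Y)%type R) :=
  [set pi | (forall A, measurable A -> pushforward pi fst A = ntw_mu X A) /\
            (forall B, measurable B -> pushforward pi snd B = ntw_mu Y B)].

Definition distortion X Y (q : (borel X * borel Y) * (borel X * borel Y)) :
    \bar R :=
  (mdist (ntw_omega (q.1.1, q.2.1)) (ntw_omega (q.1.2, q.2.2)))%:E.

Definition GW X Y : \bar R :=
  (2^-1)%R%:E * ereal_inf [set 'N[pi \x pi]_p[@distortion X Y] | pi in @coupling X Y].

Definition weak_iso X Y : Prop :=
  exists W : network Z p,
  exists (phiX : borel W -> borel X) (phiY : borel W -> borel Y),
  [/\ measurable_fun setT phiX /\ measurable_fun setT phiY,
      forall A, measurable A -> pushforward (ntw_mu W) phiX A = ntw_mu X A,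
      forall B, measurable B -> pushforward (ntw_mu W) phiY B = ntw_mu Y B &
      {ae ntw_mu W \x ntw_mu W, forall w,
        ntw_omega w = ntw_omega (phiX w.1, phiX w.2) /\
        ntw_omega w = ntw_omega (phiY w.1, phiY w.2)}].

(* Classes are plain predicates: the type of all networks is too large for
   the universe of the library's set. *)
Definition weak_class X : network Z p -> Prop := fun Y => weak_iso X Y.

Definition network_quotient : Type :=
  {C : network Z p -> Prop | exists X, C = weak_class X}.

Definition class_repr (C : network_quotient) : network Z p :=
  projT1 (cid (svalP C)).

(* GW X Y depends only on the weak isomorphism classes of X and Y, so the
   choice of representatives is immaterial. *)
Definition GW_quotient (C D : network_quotient) : \bar R :=
  GW (class_repr C) (class_repr D).

End gromov_wasserstein.

(* Main.v *)
From HB Require Import structures.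
Require Import Defs.
From mathcomp Require Import all_boot all_order all_algebra.
From mathcomp Require Import all_classical all_reals all_analysis.
From mathcomp Require Import measurable_realfun ess_sup_inf.
From mathcomp Require Import ring lra.

Set Implicit Arguments.
Unset Strict Implicit.
Unset Printing Implicit Defensive.

Import Order.TTheory GRing.Theory Num.Theory.
Import numFieldNormedType.Exports.

Local Open Scope classical_set_scope.
Local Open Scope ring_scope.
Local Open Scope ereal_scope.

(** A point [z] of the target space gives the network whose kernel is constantly
    [z], and the distance between two such networks is half of that between
    the points, because every coupling sees the same constant distortion. So a
    Cauchy sequence of points gives a Cauchy sequence of classes. If these
    converge to the class of a network [L], then the distance from the
    kernel of [L] to the points tends to [0] in norm, hence, along a fast
    subsequence, at almost every pair of points of [L]; at any such pair the
    value of the kernel is a limit of the points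
    ([complete_network_quotient_complete_metric]).

    Conversely, let the target space be complete and let a Cauchy sequence of
    classes be given. Choose a subsequence of networks [Y_k] and couplings
    [pi_k] of [Y_k] with [Y_(k+1)] whose distortions are summable. If all the
    couplings live on one probability space, that is, if there are random
    points [f_k] of [Y_k] such that each [(f_k, f_(k+1))] has law [pi_k]
    ([glue_networks]), then the kernels pulled back along the [f_k] have
    summable increments, so they converge almost everywhere, and in norm, to
    a kernel on that space, which is the limit network
    ([complete_metric_complete_network_quotient]). Gluing also gives the
    triangle inequality ([GW_triangle]), which carries the conclusion from
    the subsequence to the sequence and makes the choice of representatives
    irrelevant.

    The gluing works with conditional densities of sets. The mass that the Markov chain with
    transition laws [pi_k] gives to a finite-dimensional rectangle is an
    iterated Radon-Nikodym derivative ([chain_density]), and it is additive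
    in each side of the rectangle ([chain_mass_split]) with the right
    two-dimensional marginals ([chain_mass_pair]). A Polish space is a
    measurable retract of the space of bit sequences ([polish_coding]), so
    only the masses of finite systems of conditions on bits matter. Listing
    all the bits of all the points in a single sequence turns these masses
    into an additive weight on the binary tree, which is realized on [0, 1)
    by cutting it into intervals of the prescribed lengths
    ([unit_law_random_bits]). Countable additivity thus comes from Lebesgue
    measure, and the limit network lives on the real line. *)

(** * Measurable maps into metric spaces *)

Lemma measurable_preimage_generated d (T : measurableType d) (U : Type)
    (G : set (set U)) (f : T -> U) :
  (forall A, G A -> measurable (f @^-1` A)) ->
  forall A, <<s G >> A -> measurable (f @^-1` A).
Proof.
move=> mf; apply: smallest_sub => //; split.
- by rewrite /= preimage_set0; exact: measurable0.
- move=> A mA /=; rewrite setTD preimage_setC; exact: measurableC.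
- by move=> F mF /=; rewrite preimage_bigcup; exact: bigcupT_measurable.
Qed.

Lemma separable_seq (R : realType) (Z : metricType R) (z0 : Z) : separable Z ->
  exists q : nat -> Z,
    forall (z : Z) (e : R), (0 < e)%R -> exists n, (mdist z (q n) < e)%R.
Proof.
move=> [D cD dD].
have [q qD] : exists q : nat -> Z, D `<=` range q.
  have [D0|/set0P[w Dw]] := eqVneq D set0.
    by exists (fun _ => z0); rewrite D0.
  have [f fi] := countable_injP _ cD.
  exists (fun n => xget z0 [set z | D z /\ f z = n]) => z Dz.
  exists (f z) => //; case: xgetP => [y _ [Dy fyz]|/(_ z)]; last first.
    by move=> /=; tauto.
  by apply: fi => //; rewrite inE.
exists q => z e e0.
have : open (ball z e)^° by exact: open_interior.
move/(dD _ _) => []; first by exists z; exact: nbhsx_ballx.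
move=> y [/interior_subset zy /qD[n _ qny]].
by exists n; rewrite qny; move: zy; rewrite ballEmdist.
Qed.

Lemma open_mdist_ball (R : realType) (Z : metricType R) (z : Z) (e : R) :
  open [set y | (mdist z y < e)%R].
Proof.
rewrite openE => y /= zy; apply/nbhs_ballP; exists (e - mdist z y)%R => /=.
  by rewrite subr_gt0.
move=> x; rewrite ballEmdist/= => yx.
by have := metric_triangle z y x; lra.
Qed.

Section into_metric.
Context (R : realType) (Z : metricType R) d (T : measurableType d).
Implicit Types f g : T -> Z.

(** Separability makes the distance measurable on the product: it is less than
    [r] at [(f x, g x)] iff some point of a countable dense set lies within
    [s] of [f x] and [r - s] of [g x] for some rational [s]. *)
Lemma measurable_mdist f g : separable Z ->
  borel_measurable f -> borel_measurable g ->
  measurable_fun setT (fun x => mdist (f x) (g x)).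
Proof.
move=> sZ mf mg.
have [q qd] := separable_seq (f point) sZ.
have mball (h : T -> Z) z (s : R) : borel_measurable h ->
    measurable [set x | (mdist (h x) z < s)%R].
  move=> mh; have [s0|s0] := ltP 0%R s; last first.
    rewrite (_ : [set _ | _] = set0) ?measurable0//.
    apply/seteqP; split => // x /= /lt_le_trans /(_ s0).
    by rewrite ltNge mdist_ge0.
  rewrite [X in measurable X](_ : _ = h @^-1` [set y | (mdist z y < s)%R]).
    by apply: mh; apply: sub_sigma_algebra; exact: open_mdist_ball.
  by apply/seteqP; split => x /=; rewrite metric_sym.
move=> mT; apply: (measurability _ (RGenInftyO.measurableE R)) => //.
move=> /= _ [_ [r ->] <-]; rewrite setTI.
rewrite [X in measurable X](_ : _ = \bigcup_n \bigcup_(s : rat)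
   ([set x | (mdist (f x) (q n) < ratr s)%R] `&`
    [set x | (mdist (g x) (q n) < r - ratr s)%R])); last first.
  apply/seteqP; split => x /=; rewrite in_itv/=.
  (* A dense point within [e] of [f x] loses at most [2 e] in the triangle
     inequality, and the choice of [s] at most [e] more. *)
  - move=> fgr; pose e := ((r - mdist (f x) (g x)) / 4)%R.
    have e0 : (0 < e)%R by rewrite divr_gt0// subr_gt0.
    have [n fqn] := qd (f x) e e0.
    have /rat_in_itvoo[s] : (mdist (f x) (q n) < mdist (f x) (q n) + e)%R.
      by rewrite ltrDl.
    rewrite in_itv/= => /andP[s1 s2].
    exists n => //; exists s => //; split => //=.
    have := metric_triangle (g x) (f x) (q n).
    rewrite (metric_sym (g x) (f x)) => tri.
    have eE : (4 * e = r - mdist (f x) (g x))%R by rewrite /e; field.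
    by lra.
  - move=> [n _ [s _ [/= h1 h2]]].
    have := metric_triangle (f x) (q n) (g x).
    by rewrite (metric_sym (q n)) => tri; lra.
apply: bigcupT_measurable => n; apply: bigcupT_measurable_rat => s.
by apply: measurableI; exact: mball.
Qed.

End into_metric.

Section limits.
Context (R : realType) (Z : metricType R).

Definition mcauchy (u : nat -> Z) : Prop := forall e : R, (0 < e)%R ->
  exists N : nat, forall m n : nat, (N <= m)%N -> (N <= n)%N ->
    (mdist (u m) (u n) < e)%R.

Definition mconverges (u : nat -> Z) (l : Z) : Prop := forall e : R,
  (0 < e)%R -> exists N : nat, forall n : nat, (N <= n)%N ->
    (mdist (u n) l < e)%R.

Lemma mconverges_unique u l l' : mconverges u l -> mconverges u l' -> l = l'.
Proof.
move=> ul ul'; apply: mdist_positivity; apply/eqP.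
rewrite eq_le mdist_ge0 andbT; apply/ler_addgt0Pr => e e0; rewrite add0r.
have [N hN] := ul _ (divr_gt0 e0 (ltr0Sn _ 1)).
have [M hM] := ul' _ (divr_gt0 e0 (ltr0Sn _ 1)).
have := hN (maxn N M) (leq_maxl _ _); have := hM (maxn N M) (leq_maxr _ _).
have := metric_triangle l (u (maxn N M)) l'; rewrite (metric_sym l (u _)).
by move: (u _) => v; lra.
Qed.

Lemma mconverges_mcauchy u l : mconverges u l -> mcauchy u.
Proof.
move=> ul e e0; have [N hN] := ul _ (divr_gt0 e0 (ltr0Sn _ 1)).
exists N => m n /hN hm /hN hn.
by have := metric_triangle (u m) l (u n); rewrite (metric_sym l (u n)); lra.
Qed.

Lemma mcauchy_converges u : complete_metric Z -> mcauchy u ->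
  exists l, mconverges u l.
Proof.
move=> cZ cu; have [|l hl] := cZ u.
  move=> e e0; have [N hN] := cu e e0; exists N => m n Nm Nn.
  by rewrite lte_fin; exact: hN.
by exists l => e e0; have [N hN] := hl e e0; exists N => n /hN; rewrite lte_fin.
Qed.

Context d (T : measurableType d).

Let lt_mdist_measurable (f g : T -> Z) (e : R) : separable Z ->
  borel_measurable f -> borel_measurable g ->
  measurable [set x | (mdist (f x) (g x) < e)%R].
Proof.
move=> sZ mf mg; rewrite [X in measurable X](_ : _ =
  (fun x => mdist (f x) (g x)) @^-1` `]-oo, e[%classic); last first.
  by apply/seteqP; split => x /=; rewrite in_itv.
by rewrite -[X in measurable X]setTI; apply: measurable_mdist.
Qed.

Lemma measurable_mcauchy (f : nat -> T -> Z) : separable Z ->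
  (forall n, borel_measurable (f n)) ->
  measurable [set x | mcauchy (f^~ x)].
Proof.
move=> sZ mf; rewrite [X in measurable X](_ : _ = \bigcap_k \bigcup_N
   \bigcap_m \bigcap_n [set x | (mdist (f (N + m)%N x) (f (N + n)%N x)
       < k.+1%:R^-1)%R]).
  apply: bigcapT_measurable => k; apply: bigcupT_measurable => N.
  apply: bigcapT_measurable => m; apply: bigcapT_measurable => n.
  exact: lt_mdist_measurable.
apply/seteqP; split => x /=.
  move=> cx k _; have [|N hN] := cx (k.+1%:R^-1)%R; first by rewrite invr_gt0.
  by exists N => // m _ n _; apply: hN; exact: leq_addr.
move=> h e e0; have [k ke] : exists k : nat, (k.+1%:R^-1 < e)%R.
  by have [k _ hk] := near_infty_natSinv_lt (PosNum e0); exists k; exact: (hk k (leqnn k)).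
have [N _ hN] := h k I; exists N => m n Nm Nn.
by have := hN (m - N)%N I (n - N)%N I; rewrite /= !subnKC// => /lt_trans; exact.
Qed.

(** Pointwise limits of Borel maps are Borel: a limit lies in an open set iff
    the sequence is eventually at distance at least some [1/(m+1)] from its
    complement. *)
Lemma measurable_cauchy_limit (f : nat -> T -> Z) :
  separable Z -> complete_metric Z -> (forall n, borel_measurable (f n)) ->
  exists F : T -> Z, borel_measurable F /\
    forall x, mcauchy (f^~ x) -> mconverges (f^~ x) (F x).
Proof.
move=> sZ cZ mf.
pose F x := xget (f 0%N x) [set l | mconverges (f^~ x) l].
have Flim x : mcauchy (f^~ x) -> mconverges (f^~ x) (F x).
  move=> cx; have [l hl] := mcauchy_converges cZ cx.
  exact: (@xgetPex _ (f 0%N x) [set l | mconverges (f^~ x) l] (ex_intro _ l hl)).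
exists F; split => //; apply: measurable_preimage_generated => U oU.
pose K := [set x | mcauchy (f^~ x)].
have mK : measurable K by exact: measurable_mcauchy.
pose V (m : nat) := [set z | forall y, (mdist z y < m.+1%:R^-1)%R -> U y].
have mV m : <<s (@open Z) >> (V m).
  have [_ sC _] := smallest_sigma_algebra setT (@open Z).
  rewrite -[V m]setCK -setTD; apply: sC; apply: sub_sigma_algebra.
  rewrite [X in open X](_ : _ =
    \bigcup_(y in ~` U) [set z | (mdist y z < m.+1%:R^-1)%R]).
    by apply: bigcup_open => y _; exact: open_mdist_ball.
  apply/seteqP; split => z /=.
    move=> /existsNP[y] /not_implyP[zy Uy]; exists y => //=.
    by rewrite metric_sym.
  by move=> [y Uy /= yz] /(_ y); rewrite metric_sym => /(_ yz).
rewrite [X in measurable X](_ : _ =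
   (K `&` \bigcup_m \bigcup_N \bigcap_n (f (N + n)%N @^-1` (V m))) `|`
   (~` K `&` f 0%N @^-1` U)).
  apply: measurableU.
    apply: measurableI => //; apply: bigcupT_measurable => m.
    apply: bigcupT_measurable => N; apply: bigcapT_measurable => n.
    exact: mf.
  by apply: measurableI; [exact: measurableC|apply: mf; exact: sub_sigma_algebra].
apply/seteqP; split => x /=.
  move=> UF; have [Kx|nKx] := pselect (K x); last first.
    right; split => //; move: UF; rewrite /F; case: xgetP => // y _ /=.
    by move=> /mconverges_mcauchy.
  left; split => //.
  have /nbhs_ballP[e /= e0 eU] : nbhs (F x) U by exact: open_nbhs_nbhs.
  have [m me] : exists m : nat, (m.+1%:R^-1 < e / 2)%R.
    have e20 : (0 < e / 2)%R by rewrite divr_gt0.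
    by have [k _ hk] := near_infty_natSinv_lt (PosNum e20); exists k; exact: (hk k (leqnn k)).
  have m0 : (0 < m.+1%:R^-1 :> R)%R by rewrite invr_gt0.
  have [N hN] := Flim x Kx _ m0.
  exists m => //; exists N => // n _ y /= fy; apply: eU; rewrite ballEmdist/=.
  have := hN (N + n)%N (leq_addr _ _).
  have := metric_triangle (F x) (f (N + n)%N x) y.
  rewrite (metric_sym (F x) (f _ x)) => /= tri fF; move: fy tri fF me.
  by move: (m.+1%:R^-1)%R => r; lra.
move=> [[Kx [m _ [N _ hN]]]|[nKx Ufx]].
  have m0 : (0 < m.+1%:R^-1 :> R)%R by rewrite invr_gt0.
  have [M hM] := Flim x Kx _ m0.
  apply: (hN M I); exact: hM (leq_addl _ _).
rewrite /F; case: xgetP => // y _ /=.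
by move=> /mconverges_mcauchy.
Qed.

End limits.

(** * Coding a Polish space by bit sequences *)

Definition cylinder (l : seq (nat * bool)) : set (nat -> bool) :=
  [set b | all (fun q => b q.1 == q.2) l].

Notation cantor := (g_sigma_algebraType (range cylinder)).

Lemma measurable_bit (i : nat) (v : bool) :
  measurable [set b : cantor | b i = v].
Proof.
apply: sub_sigma_algebra; exists [:: (i, v)] => //.
by apply/seteqP; split => b /=; rewrite /cylinder/= andbT => /eqP.
Qed.

Section to_cantor.
Context d (T : measurableType d).

Lemma measurable_cylinder (h : T -> cantor) (l : seq (nat * bool)) :
  (forall i, measurable [set x | h x i]) -> measurable (h @^-1` cylinder l).
Proof.
move=> mh; elim: l => [|[i v] l IHl].
  by rewrite (_ : _ @^-1` _ = setT) ?measurableT//; apply/seteqP; split.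
rewrite (_ : _ @^-1` _ = [set x | h x i = v] `&` h @^-1` cylinder l).
  apply: measurableI => //; case: v; first exact: mh.
  rewrite (_ : [set _ | _] = ~` [set x | h x i]); first exact: measurableC.
  by apply/seteqP; split => x /=; [move=> ->|move/negP/negbTE].
apply/seteqP; split => x /=; rewrite /cylinder/=.
  by move=> /andP[/eqP ? ?].
by move=> [-> ->]; rewrite eqxx.
Qed.

Lemma measurable_to_cantor (h : T -> cantor) :
  (forall i, measurable [set x | h x i]) -> measurable_fun setT h.
Proof.
move=> mh _ A; rewrite setTI; apply: measurable_preimage_generated => {}A.
by move=> [l _ <-]; exact: measurable_cylinder.
Qed.

Lemma measurable_fun_borel (Z : ptopologicalType) (h : T -> borel Z) :
  measurable_fun setT h <-> borel_measurable (h : T -> Z).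
Proof.
split => mh.
  by move=> B mB; rewrite -[X in measurable X]setTI; exact: mh.
by move=> _ B mB; rewrite setTI; exact: mh.
Qed.

End to_cantor.

(** The bits of a point record in which balls of radius [1/(k+1)] around the
    points of a dense sequence it lies. Choosing one such ball for each [k]
    recovers the point as the limit of the centres, and this decoding makes
    sense and is measurable on all bit sequences, not just on codes. *)
Lemma polish_coding (R : realType) (X : ptopologicalType) : polish R X ->
  exists (c : borel X -> cantor) (g : cantor -> borel X),
    [/\ measurable_fun setT c, measurable_fun setT g & cancel c g].
Proof.
move=> [sX [M [cM [u [v [cu cv uv vu]]]]]].
have sM : separable M.
  have [D cD dD] := sX; exists (u @` D); first exact: sub_countable (card_image_le _ _) cD.
  move=> O [y Oy] oO; have ouO : open (u @^-1` O) by apply: open_comp.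
  have [|x] := dD (u @^-1` O) _ ouO; first by exists (v y); rewrite /= vu.
  by move=> [/= ux Dx]; exists (u x); split => //; exists x.
have [q qd] := separable_seq (u point) sM.
pose code (k j : nat) := pickle (k, j).
pose c (x : borel X) : cantor := fun i =>
  if @unpickle (nat * nat)%type i is Some (k, j)
  then (mdist (u x) (q j) < k.+1%:R^-1)%R else false.
have cE x k j : c x (code k j) = (mdist (u x) (q j) < k.+1%:R^-1)%R.
  by rewrite /c /code pickleK.
pose J (k : nat) (b : cantor) : nat :=
  if pselect (exists j, b (code k j)) is left h then ex_minn h else 0%N.
pose f (k : nat) (b : cantor) : M := q (J k b).
have mJ k n : measurable (J k @^-1` [set n]).
  have mex : measurable [set b : cantor | exists j, b (code k j)].
    rewrite (_ : [set _ | _] = \bigcup_j [set b : cantor | b (code k j)]).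
      by apply: bigcupT_measurable => j; exact: (measurable_bit _ true).
    by apply/seteqP; split => b /= [j]; [exists j|move=> _ ?; exists j].
  rewrite (_ : _ @^-1` _ =
    ([set b : cantor | exists j, b (code k j)] `&`
     ([set b : cantor | b (code k n)] `&`
      \bigcap_(j in [set j | (j < n)%N]) [set b : cantor | b (code k j) = false]))
    `|` (~` [set b : cantor | exists j, b (code k j)] `&` [set _ | n = 0%N])).
    apply: measurableU; apply: measurableI => //.
    - apply: measurableI; first exact: (measurable_bit _ true).
      apply: bigcap_measurableType => j _; exact: measurable_bit.
    - exact: measurableC.
    - have [->|n0] := pselect (n = 0%N).
        by rewrite (_ : [set _ | _] = setT) ?measurableT//; apply/seteqP; split.
      by rewrite (_ : [set _ | _] = set0) ?measurable0//; apply/seteqP; split.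
  apply/seteqP; split => b /=; rewrite /J; case: pselect => h.
  - case: ex_minnP => m bm hm <-; left; split => //; split => // j /= jm.
    by apply/negP => /hm; rewrite leqNgt jm.
  - by move=> <-; right.
  - move=> [[_ [bn hn]]|[/(_ h)//]].
    case: ex_minnP => m bm hm; apply/eqP; rewrite eqn_leq hm//= leqNgt.
    by apply/negP => /hn /=; rewrite bm.
  - by move=> [[/h]//|[_ ->]].
have mf k : borel_measurable (f k).
  move=> B _; rewrite (_ : _ @^-1` _ =
     \bigcup_(n in [set n | B (q n)]) (J k @^-1` [set n])).
    by apply: bigcup_measurable.
  apply/seteqP; split => b /=; first by move=> fB; exists (J k b).
  by move=> [n /= Bn Jn]; rewrite /f Jn.
have [F [mF Flim]] := measurable_cauchy_limit sM cM mf.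
exists c, (v \o F); split.
- apply: measurable_to_cantor => i; rewrite /c.
  case: unpickle => [[k j]|]; last first.
    by rewrite (_ : [set _ | _] = set0) ?measurable0//; apply/seteqP; split.
  apply: sub_sigma_algebra; rewrite (_ : [set _ | _] =
     u @^-1` [set y | (mdist (q j) y < k.+1%:R^-1)%R]).
    by apply: open_comp => //; exact: open_mdist_ball.
  by apply/seteqP; split => x /=; rewrite metric_sym.
- apply/measurable_fun_borel; apply: measurable_preimage_generated => U oU.
  rewrite comp_preimage; apply: mF; apply: sub_sigma_algebra.
  exact: open_comp.
- move=> x /=; rewrite -[RHS]uv; congr v.
  have fu : mconverges (f^~ (c x)) (u x).
    move=> e e0; have [K _ hK] := near_infty_natSinv_lt (PosNum e0).
    exists K => n Kn; apply: lt_trans (hK n Kn).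
    rewrite metric_sym /f /J; case: pselect => [h|]; last first.
      have [|j hj] := qd (u x) (n.+1%:R^-1)%R; first by rewrite invr_gt0.
      by case; exists j; rewrite cE.
    by case: ex_minnP => m; rewrite cE.
  apply: (@mconverges_unique _ _ (f^~ (c x))) => //.
  by apply: Flim; exact: mconverges_mcauchy fu.
Qed.

(** * Laws of measurable maps *)

Section law.
Context (R : realType) d1 d2 (T1 : measurableType d1) (T2 : measurableType d2).
Variables (P : {measure set T1 -> \bar R}) (f : T1 -> T2)
  (Q : {measure set T2 -> \bar R}).

Definition has_law : Prop := measurable_fun setT f /\
  forall A, measurable A -> P (f @^-1` A) = Q A.

Hypothesis fQ : has_law.

Lemma has_law_integral (D : set T2) (h : T2 -> \bar R) :
  measurable D -> measurable_fun D h -> (forall y, 0 <= h y) ->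
  \int[Q]_(y in D) h y = \int[P]_(x in f @^-1` D) h (f x).
Proof.
move=> mD mh h0; have [mf fQE] := fQ.
rewrite -(@ge0_integral_pushforward _ _ _ _ _ _ mf P D h)//.
apply: eq_measure_integral => A mA _; rewrite -fQE//.
Qed.

Lemma has_law_ae (S : T2 -> Prop) :
  {ae Q, forall y, S y} -> {ae P, forall x, S (f x)}.
Proof.
have [mf fQE] := fQ.
move=> [N [mN QN SN]]; exists (f @^-1` N); split.
- by rewrite -[X in measurable X]setTI; exact: mf.
- by rewrite fQE.
- by move=> x /= nS; exact: SN.
Qed.

(** For [p = +oo] the almost sure upper bounds have to agree. A bound upstairs
    comes down because the set where [h] exceeds it is measurable. *)
Lemma has_law_Lnorm (p : \bar R) (h : T2 -> \bar R) : 1 <= p ->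
  measurable_fun setT h -> 'N[Q]_p[h] = 'N[P]_p[h \o f].
Proof.
move=> p1 mh; have [mf fQE] := fQ.
have QT : Q setT = P setT by rewrite -fQE ?measurableT.
rewrite unlock; case: p p1 => [r _| _|//].
  congr (_ `^ _); rewrite has_law_integral//.
    by apply: (measurableT_comp (measurable_poweR r)); exact: measurableT_comp.
  by move=> y; exact: poweR_ge0.
rewrite QT; case: ifPn => // P0; congr ereal_inf.
have mh' : measurable_fun setT (abse \o h) by exact: measurableT_comp.
apply/seteqP; split => y /=; first exact: has_law_ae.
have mhf : measurable_fun setT ((abse \o h) \o f) by exact: measurableT_comp.
move=> /(ae_le_measureP _ _ mhf) H; apply/(ae_le_measureP _ _ mh').
rewrite -fQE; first by rewrite -comp_preimage.
by rewrite -[X in measurable X]setTI; apply: mh' => //; exact: emeasurable_itv.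
Qed.

End law.

Lemma has_law_comp (R : realType) d1 d2 d3 (T1 : measurableType d1)
    (T2 : measurableType d2) (T3 : measurableType d3)
    (P : {measure set T1 -> \bar R}) (Q : {measure set T2 -> \bar R})
    (S : {measure set T3 -> \bar R}) (f : T1 -> T2) (g : T2 -> T3) :
  has_law P f Q -> has_law Q g S -> has_law P (g \o f) S.
Proof.
move=> [mf fQ] [mg gS]; split; first exact: measurableT_comp.
move=> A mA; rewrite comp_preimage fQ ?gS//.
by rewrite -[X in measurable X]setTI; exact: mg.
Qed.

Section image_law.
Context (R : realType) d1 d2 (T1 : measurableType d1) (T2 : measurableType d2).
Variables (P : probability T1 R) (f : T1 -> T2) (mf : measurable_fun setT f).

(** The measurability proof is an argument so that it can be found when the
    measure structure is inferred. *)
Definition image_law of measurable_fun setT f : set T2 -> \bar R :=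
  fun A => P (f @^-1` A).

Local Notation m := (image_law mf).

Let m0 : m set0 = 0.
Proof. by rewrite /m preimage_set0 measure0. Qed.

Let m_ge0 A : 0 <= m A. Proof. exact: measure_ge0. Qed.

Let m_sigma_additive : semi_sigma_additive m.
Proof. exact: (@measure_semi_sigma_additive _ _ _ (pushforward P f)). Qed.

HB.instance Definition _ := isMeasure.Build _ _ _ m m0 m_ge0 m_sigma_additive.

Let mT : m setT = 1.
Proof. by rewrite /m preimage_setT probability_setT. Qed.

HB.instance Definition _ := Measure_isProbability.Build _ _ _ m mT.

Definition image_probability : probability T2 R := m.

Lemma has_law_image : has_law P f image_probability. Proof. by []. Qed.

End image_law.

Section product_law.
Context (R : realType) d1 d2 d3 d4 (T1 : measurableType d1)
  (T2 : measurableType d2) (T3 : measurableType d3) (T4 : measurableType d4).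
Variables (P1 : probability T1 R) (P2 : probability T2 R)
  (Q1 : probability T3 R) (Q2 : probability T4 R).

Lemma has_law_prod (f : T1 -> T3) (g : T2 -> T4) :
  has_law P1 f Q1 -> has_law P2 g Q2 ->
  has_law (P1 \x P2) (fun x => (f x.1, g x.2)) (Q1 \x Q2).
Proof.
move=> [mf fQ] [mg gQ].
have mfg : measurable_fun setT (fun x : T1 * T2 => (f x.1, g x.2)).
  by apply: measurable_fun_pair; exact: measurableT_comp.
split => // A mA; symmetry.
apply: (@product_measure_unique _ _ _ _ _ Q1 Q2 (image_probability (P1 \x P2) mfg)) => //.
move=> B C mB mC; rewrite /= /image_law -fQ// -gQ//.
rewrite -product_measure1E//.
- by rewrite -[X in measurable X]setTI; exact: mf.
- by rewrite -[X in measurable X]setTI; exact: mg.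
Qed.

Lemma has_law_fst : has_law (P1 \x P2) fst P1.
Proof.
split; first exact: measurable_fst.
move=> A mA; rewrite (_ : fst @^-1` A = A `*` setT).
  by rewrite /= product_measure1E// [X in _ * X](probability_setT P2) mule1.
by apply/seteqP; split => x //= [].
Qed.

Lemma has_law_snd : has_law (P1 \x P2) snd P2.
Proof.
split; first exact: measurable_snd.
move=> A mA; rewrite (_ : snd @^-1` A = setT `*` A).
  by rewrite /= product_measure1E// [X in X * _](probability_setT P1) mul1e.
by apply/seteqP; split => x //= [].
Qed.

End product_law.

(** * Transport of densities along a coupling *)

Section transport.
Context (R : realType) d1 d2 (T1 : measurableType d1) (T2 : measurableType d2).
Variables (mu : probability T1 R) (nu : probability T2 R)
  (pi : probability (T1 * T2)%type R).
Hypotheses (pi_mu : has_law pi fst mu) (pi_nu : has_law pi snd nu).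

Definition finite_density (g : T1 -> \bar R) : Prop :=
  [/\ forall x, 0 <= g x, measurable_fun setT g & \int[mu]_x g x < +oo].

(** [h y] is the conditional expectation of [g] given that the second point of
    the coupling is [y]. *)
Definition is_transport (g : T1 -> \bar R) (h : T2 -> \bar R) : Prop :=
  [/\ forall y, 0 <= h y, measurable_fun setT h &
      forall B, measurable B ->
        \int[nu]_(y in B) h y = \int[pi]_(q in snd @^-1` B) g q.1].

Section image_density.
Variables (g : T1 -> \bar R) (fg : finite_density g).

Let m (B : set T2) : \bar R := \int[pi]_(q in snd @^-1` B) g q.1.

Let mg : measurable_fun setT (fun q : T1 * T2 => g q.1).
Proof. by case: fg => _ mg _; exact: measurableT_comp. Qed.

Let m0 : m set0 = 0.
Proof. by rewrite /m preimage_set0 integral_set0. Qed.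

Let m_ge0 B : 0 <= m B.
Proof. by case: fg => g0 _ _; apply: integral_ge0. Qed.

Let msnd (B : set T2) : measurable B -> measurable (@snd T1 T2 @^-1` B).
Proof.
by move=> mB; rewrite -[X in measurable X]setTI; exact: measurable_snd.
Qed.

Let m_sigma_additive : semi_sigma_additive m.
Proof.
case: fg => g0 _ _ F mF tF mUF; rewrite /m; apply: cvg_toP.
  apply: ereal_nondecreasing_is_cvgn => i j ij.
  apply: lee_sum_nneg_natr => // k _ _.
  by apply: integral_ge0.
rewrite preimage_bigcup ge0_integral_bigcup//=.
- by move=> k; exact: msnd.
- by apply: measurable_funTS.
- by apply/trivIsetP => i j _ _ ij; rewrite -preimage_setI;
    move/trivIsetP : tF => /(_ _ _ I I ij) ->; rewrite preimage_set0.
Qed.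

HB.instance Definition _ := isMeasure.Build _ _ _ m m0 m_ge0 m_sigma_additive.

Let mT : m setT = \int[mu]_x g x.
Proof.
by case: fg => g0 mg' _; rewrite (has_law_integral pi_mu).
Qed.

Let m_fin : fin_num_fun m.
Proof.
move=> B mB; rewrite ge0_fin_numE//.
case: fg => _ _; rewrite -mT; apply: le_lt_trans.
by apply: le_measure => //; rewrite inE.
Qed.

HB.instance Definition _ := Measure_isFinite.Build _ _ _ m m_fin.

(** Weighting the coupling by [g] and projecting to the second factor gives a
    finite measure dominated by [nu]; [h] is its Radon-Nikodym derivative. *)
Lemma transport_exists : exists h, is_transport g h.
Proof.
have [|h [h0 hfin hint hE]] :=
  @radon_nikodym_sigma_finite _ _ _ nu [the {finite_measure set T2 -> \bar R} of m].
  apply/null_content_dominatesP => B mB nuB0.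
  apply: null_set_integral; [exact: msnd| |].
    by apply: measurable_funTS.
  by case: pi_nu => _ ->.
exists h; split => //; first exact: measurable_int hint.
by move=> B mB; rewrite -hE.
Qed.

End image_density.

Lemma transport_mass g h : finite_density g -> is_transport g h ->
  \int[nu]_y h y = \int[mu]_x g x.
Proof.
move=> [g0 mg _] [_ _ hE]; rewrite hE// preimage_setT.
by rewrite (has_law_integral pi_mu).
Qed.

Lemma ae_eq_transport g g' h h' : finite_density g -> finite_density g' ->
  is_transport g h -> is_transport g' h' ->
  {ae mu, forall x, g x = g' x} -> {ae nu, forall y, h y = h' y}.
Proof.
move=> fg fg' tgh [h'0 mh' hE'] gg'.
have [h0 mh hE] := tgh; have [g0 mg _] := fg; have [g'0 mg' _] := fg'.
have : ae_eq nu setT h h'; last by apply: filterS => y /(_ I).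
apply: integral_ae_eq => //.
  apply/integrableP; split => //; under eq_integral do rewrite gee0_abs//.
  by rewrite (transport_mass fg tgh); case: fg.
move=> B _ mB; rewrite hE// hE'//; apply: ge0_ae_eq_integral => //.
- by rewrite -[X in measurable X]setTI; exact: measurable_snd.
- by apply: measurable_funTS; exact: measurableT_comp.
- by apply: measurable_funTS; exact: measurableT_comp.
- by apply: filterS (has_law_ae pi_mu gg') => q gq _.
Qed.

End transport.

(** * The Markov chain of a sequence of couplings *)

Section markov_chain.
Context (R : realType) (d : nat -> measure_display)
  (T : forall n, measurableType (d n)).
Variables (mu : forall n, probability (T n) R)
  (pi : forall n, probability (T n * T n.+1)%type R).
Hypotheses (pi_fst : forall n, has_law (pi n) fst (mu n))
  (pi_snd : forall n, has_law (pi n) snd (mu n.+1)).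

Definition transport n (g : T n -> \bar R) : T n.+1 -> \bar R :=
  xget (cst 0) [set h | is_transport (mu n.+1) (pi n) g h].

(** The density, with respect to [mu n], of the law of the [n]-th point of the
    Markov chain restricted to the event that the [i]-th point lies in [A i]
    for all [i <= n]. Conditional expectations replace transition kernels, so
    identities between densities hold only almost everywhere. *)
Fixpoint chain_density (A : forall n, set (T n)) n : T n -> \bar R :=
  match n with
  | 0%N => fun x => (\1_(A 0%N) x)%:E
  | k.+1 => fun x => (\1_(A k.+1) x)%:E * transport (chain_density A (n := k)) x
  end.
Arguments chain_density : clear implicits.

Definition chain_mass (A : forall n, set (T n)) n : \bar R :=
  \int[mu n]_x chain_density A n x.

Implicit Types A B C : forall n, set (T n).
Local Notation measurable_family A := (forall n, measurable (A n)).

Lemma transportP n (g : T n -> \bar R) : finite_density (mu n) g ->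
  is_transport (mu n.+1) (pi n) g (transport g).
Proof.
move=> fg; have [h hP] := transport_exists (pi_fst n) (pi_snd n) fg.
exact: (@xgetPex _ (cst 0) _ (ex_intro _ h hP)).
Qed.

Lemma finite_density_restrict n (g : T n -> \bar R) (B : set (T n)) :
  measurable B -> finite_density (mu n) g ->
  finite_density (mu n) (fun x => (\1_B x)%:E * g x).
Proof.
move=> mB [g0 mg gfin]; have m1 : measurable_fun setT (EFin \o \1_B : T n -> \bar R).
  by apply/measurable_EFinP; exact: measurable_indic.
have mBg : measurable_fun setT (fun x => (\1_B x)%:E * g x).
  exact: emeasurable_funM.
split => //; first by move=> x; rewrite mule_ge0// lee_fin indicE.
apply: le_lt_trans gfin; apply: ge0_le_integral => //.
- by move=> x _; rewrite mule_ge0// lee_fin indicE.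
- move=> x _; rewrite indicE; case: (x \in B); first by rewrite mul1e.
  by rewrite mul0e.
Qed.

Lemma finite_density_cst1 n : finite_density (mu n) (cst 1).
Proof.
split => //; rewrite integral_cst// mul1e.
by rewrite [X in X < _](probability_setT (mu n)) ltry.
Qed.

Lemma finite_density_transport n (g : T n -> \bar R) : finite_density (mu n) g ->
  finite_density (mu n.+1) (transport g).
Proof.
move=> fg; have tg := transportP fg; have [h0 mh _] := tg; split => //.
by rewrite (transport_mass (pi_fst n) fg tg); case: fg.
Qed.

Lemma chain_density_finite A n : measurable_family A ->
  finite_density (mu n) (chain_density A n).
Proof.
move=> mA; elim: n => [|n IHn] /=.
  have := finite_density_restrict (mA 0%N) (finite_density_cst1 0%N).
  by under [X in finite_density _ X -> _]eq_fun do rewrite /= mule1.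
apply: finite_density_restrict => //; exact: finite_density_transport.
Qed.

Lemma eq_chain_density A B n : (forall i, (i <= n)%N -> A i = B i) ->
  chain_density A n = chain_density B n.
Proof.
elim: n => [|n IHn] AB /=; first by rewrite AB.
by rewrite AB// IHn// => i iN; apply: AB; exact: leqW.
Qed.

Lemma chain_mass_stable A n : measurable_family A -> A n.+1 = setT ->
  chain_mass A n.+1 = chain_mass A n.
Proof.
move=> mA AT; rewrite /chain_mass /=.
under eq_integral do rewrite AT indicT mul1e.
have fA := chain_density_finite n mA.
exact: (transport_mass (pi_fst n) fA (transportP fA)).
Qed.

(** Before [j] the three densities involve the same sets; at [j] the indicator
    splits, and afterwards the splitting is preserved because a transport is
    determined almost everywhere by its integrals, which are linear. *)
Lemma chain_density_split A B C j n : measurable_family A ->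
  measurable_family B -> measurable_family C ->
  (forall i, i != j -> B i = A i) -> (forall i, i != j -> C i = A i) ->
  B j `|` C j = A j -> B j `&` C j = set0 -> (j <= n)%N ->
  {ae mu n, forall x, chain_density A n x =
                      chain_density B n x + chain_density C n x}.
Proof.
move=> mA mB mC BA CA BCU BCI; have indE x :
    (\1_(A j) x)%:E = (\1_(B j) x)%:E + (\1_(C j) x)%:E :> \bar R.
  rewrite -EFinD; congr EFin; rewrite -BCU !indicE in_setU.
  have [xB|xB] := boolP (x \in B j); have [xC|xC] := boolP (x \in C j) => //=.
  - have : (B j `&` C j) x by split; exact: set_mem.
    by rewrite BCI.
  - by rewrite addr0.
  - by rewrite add0r.
  - by rewrite addr0.
elim: n => [|n IHn].
  rewrite leqn0 => /eqP j0; move: j0 indE {BA CA BCU BCI} => -> indE.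
  exact: nearW.
have indD x : (\1_(A j) x)%:E = (\1_(B j) x)%:E + (\1_(C j) x)%:E :> \bar R.
  exact: indE.
rewrite leq_eqVlt => /orP[/eqP jE|jn].
  have eqA D : (forall i, i != j -> D i = A i) ->
      chain_density D n = chain_density A n.
    move=> DA; apply: eq_chain_density => i iN; apply: DA.
    by rewrite jE; apply: contraTneq iN => ->; rewrite ltnn.
  move: (eqA B BA) (eqA C CA); rewrite {eqA}.
  move: jE indE {indD IHn BA CA BCU BCI} => -> indE EB EC; apply: nearW => x /=.
  rewrite EB EC indE ge0_muleDl// lee_fin indicE//.
have {}IHn := IHn jn.
have fA := chain_density_finite n mA.
have fB := chain_density_finite n mB.
have fC := chain_density_finite n mC.
have [B0 mB' Bfin] := fB; have [C0 mC' Cfin] := fC.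
have fBC : finite_density (mu n) (fun x => chain_density B n x + chain_density C n x).
  split; first by move=> x; rewrite adde_ge0.
    exact: emeasurable_funD.
  by rewrite ge0_integralD// lte_add_pinfty.
have [sB0 msB sBE] := transportP fB; have [sC0 msC sCE] := transportP fC.
have tBC : is_transport (mu n.+1) (pi n)
    (fun x => chain_density B n x + chain_density C n x)
    (fun y => transport (chain_density B n) y + transport (chain_density C n) y).
  split; first by move=> y; rewrite adde_ge0.
    exact: emeasurable_funD.
  move=> D mD; rewrite ge0_integralD//; [|exact: measurable_funTS..].
  rewrite sBE// sCE// ge0_integralD//.
  - by rewrite -[X in measurable X]setTI; exact: measurable_snd.
  - by apply: measurable_funTS; exact: measurableT_comp.
  - by apply: measurable_funTS; exact: measurableT_comp.
apply: filterS (ae_eq_transport (pi_fst n) fA fBC (transportP fA) tBC IHn).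
move=> y yE /=; have nj : n.+1 != j by rewrite gtn_eqF.
by rewrite BA// CA// yE muleDr// ge0_adde_def// inE.
Qed.

Lemma chain_mass_split A B C j n : measurable_family A ->
  measurable_family B -> measurable_family C ->
  (forall i, i != j -> B i = A i) -> (forall i, i != j -> C i = A i) ->
  B j `|` C j = A j -> B j `&` C j = set0 -> (j <= n)%N ->
  chain_mass A n = chain_mass B n + chain_mass C n.
Proof.
move=> mA mB mC BA CA BCU BCI jn.
have [A0 mA' _] := chain_density_finite n mA.
have [B0 mB' _] := chain_density_finite n mB.
have [C0 mC' _] := chain_density_finite n mC.
rewrite /chain_mass -ge0_integralD//; apply: ge0_ae_eq_integral => //.
- exact: emeasurable_funD.
- by move=> x _; rewrite adde_ge0.
- have := chain_density_split mA mB mC BA CA BCU BCI jn.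
  by apply: filterS => x xE _.
Qed.

(** The constant [1] transports to the constant [1]: this is the condition on
    the second marginal. *)
Lemma chain_density_free A n : measurable_family A ->
  (forall i, (i <= n)%N -> A i = setT) ->
  {ae mu n, forall x, chain_density A n x = 1}.
Proof.
move=> mA; elim: n => [|n IHn] AT.
  by apply: nearW => x /=; rewrite AT// indicT.
have {}IHn : {ae mu n, forall x, chain_density A n x = cst 1 x}.
  by apply: IHn => i iN; apply: AT; exact: leqW.
have fA := chain_density_finite n mA.
have t1 : is_transport (mu n.+1) (pi n) (cst 1) (cst 1).
  split => // B mB; rewrite !integral_cst//; last first.
    by rewrite -[X in measurable X]setTI; exact: measurable_snd.
  by rewrite !mul1e; case: (pi_snd n) => _ ->.
apply: filterS (ae_eq_transport (pi_fst n) fA (finite_density_cst1 n)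
  (transportP fA) t1 IHn).
by move=> x xE /=; rewrite AT// indicT mul1e.
Qed.

(** While the chain is free its density is [1], so [A n] is the only restriction
    in force when the last coupling is applied. *)
Lemma chain_mass_pair A n : measurable_family A ->
  (forall i, (i < n)%N -> A i = setT) ->
  chain_mass A n.+1 = pi n (A n `*` A n.+1).
Proof.
move=> mA AT; have fA := chain_density_finite n mA.
have [h0 mh hE] := transportP fA.
have AE : {ae mu n, forall x, chain_density A n x = (\1_(A n) x)%:E}.
  case: n => [|n] in AT {fA h0 mh hE} *; first exact: nearW.
  have fA := chain_density_finite n mA.
  have t1 : is_transport (mu n.+1) (pi n) (cst 1) (cst 1).
    split => // B mB; rewrite !integral_cst//; last first.
      by rewrite -[X in measurable X]setTI; exact: measurable_snd.
    by rewrite !mul1e; case: (pi_snd n) => _ ->.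
  apply: filterS (ae_eq_transport (pi_fst n) fA (finite_density_cst1 n)
    (transportP fA) t1 (chain_density_free mA AT)).
  by move=> x xE /=; rewrite xE mule1.
rewrite /chain_mass /=.
transitivity (\int[mu n.+1]_(y in A n.+1) transport (chain_density A n) y).
  rewrite [RHS]integral_mkcond; apply: eq_integral => y _.
  by rewrite epatch_indic /= muleC.
rewrite hE//; have mS : measurable (@snd (T n) (T n.+1) @^-1` A n.+1).
  by rewrite -[X in measurable X]setTI; exact: measurable_snd.
transitivity (\int[pi n]_(q in snd @^-1` A n.+1) (\1_(fst @^-1` A n) q)%:E).
  have [A0 mA' _] := fA.
  apply: ge0_ae_eq_integral => //.
  - by apply: measurable_funTS; exact: measurableT_comp.
  - apply: measurable_funTS; apply/measurable_EFinP; apply: measurable_indic.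
    by rewrite -[X in measurable X]setTI; exact: measurable_fst.
  - by apply: filterS (has_law_ae (pi_fst n) AE) => q qE _; rewrite qE !indicE.
rewrite integral_indic//.
by rewrite -[X in measurable X]setTI; exact: measurable_fst.
Qed.

End markov_chain.

(** * Random bit sequences on the unit interval *)

Section unit_interval.
Context (R : realType).

Lemma measurable_id_borel :
  measurable_fun setT (idfun : measurableTypeR R -> borel R).
Proof.
move=> _ A; rewrite setTI; apply: measurable_preimage_generated => U oU.
exact: open_measurable.
Qed.

Let D : set (measurableTypeR R) := `[0%R, 1%R[%classic.

Let mD : measurable D. Proof. exact: measurable_itv. Qed.

Definition unit_measure (A : set (borel R)) : \bar R :=
  lebesgue_measure ((A : set (measurableTypeR R)) `&` D).

Let unit0 : unit_measure set0 = 0.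
Proof. by rewrite /unit_measure set0I measure0. Qed.

Let unit_ge0 A : 0 <= unit_measure A.
Proof. exact: measure_ge0. Qed.

Let unit_sigma_additive : semi_sigma_additive unit_measure.
Proof.
have mi := measurable_id_borel.
exact: (@measure_semi_sigma_additive _ _ _
  (pushforward (mrestr lebesgue_measure mD) (idfun : _ -> borel R))).
Qed.

HB.instance Definition _ := isMeasure.Build _ _ _ unit_measure
  unit0 unit_ge0 unit_sigma_additive.

Let unitT : unit_measure setT = 1.
Proof.
by rewrite /unit_measure setTI lebesgue_measure_itv/= lte01 oppr0 adde0.
Qed.

HB.instance Definition _ := Measure_isProbability.Build _ _ _ unit_measure unitT.

Definition unit_law : probability (borel R) R := unit_measure.

Lemma unit_law_itv (A : set (borel R)) (a b : R) :
  (A : set R) `&` `[0%R, 1%R[%classic = `[a, b[%classic ->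
  (a <= b)%R -> unit_law A = (b - a)%:E.
Proof.
move=> Aab ab; rewrite /unit_law /= /unit_measure Aab lebesgue_measure_itv/=.
rewrite lte_fin; case: ifPn => //; rewrite -leNgt => ba.
by rewrite (_ : b = a) ?subrr//; apply/eqP; rewrite eq_le ba.
Qed.

End unit_interval.
Arguments unit_law R : clear implicits.

(** The most recent bit comes first. *)
Fixpoint bit_prefix (b : nat -> bool) (n : nat) : seq bool :=
  if n is k.+1 then b k :: bit_prefix b k else [::].

Section bit_tree.
Context (R : realType) (gamma : seq bool -> R).
Hypotheses (gamma_nil : gamma [::] = 1%R) (gamma_ge0 : forall s, (0 <= gamma s)%R)
  (gamma_split : forall s, gamma s = (gamma (false :: s) + gamma (true :: s))%R).

(** The words of length [n] cut [0, 1) into consecutive intervals of lengths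
    [gamma s]; [word_left s] is the left end point of the interval of [s]. *)
Fixpoint word_left (s : seq bool) : R :=
  if s is b :: s' then
    (word_left s' + (if b then gamma (false :: s') else 0))%R
  else 0%R.

Let next_bit (t : R) (s : seq bool) : bool :=
  (word_left s + gamma (false :: s) <= t)%R.

Fixpoint word_at (t : R) (n : nat) : seq bool :=
  if n is k.+1 then next_bit t (word_at t k) :: word_at t k else [::].

(** Following the intervals that contain [t] down the tree. *)
Definition random_bits (t : borel R) : cantor := fun k => next_bit t (word_at t k).

Lemma bit_prefix_random_bits t n : bit_prefix (random_bits t) n = word_at t n.
Proof. by elim: n => //= n ->. Qed.

(* The nested half-open intervals partition [0, 1) at every level, so a word is
   read off at [t] exactly on its own interval. *)
Let word_atP (t : R) (s : seq bool) : (0 <= t < 1)%R ->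
  word_at t (size s) = s <-> (word_left s <= t < word_left s + gamma s)%R.
Proof.
move=> t01; elim: s => [|b s IHs] /=.
  by rewrite gamma_nil add0r t01.
have g0 := gamma_ge0 (false :: s); have g1 := gamma_ge0 (true :: s).
have gE := gamma_split s.
split.
  move=> [be se]; have := IHs.1 se; rewrite se in be.
  move: be; rewrite /next_bit; case: b.
    by move=> h /andP[h1 h2]; apply/andP; split => //; lra.
  move=> /negbT; rewrite -ltNge => h /andP[h1 h2]; apply/andP; split => //; lra.
move=> h; have se : word_at t (size s) = s.
  by apply/IHs; case: b h => /andP[h1 h2]; apply/andP; split; lra.
rewrite se; congr (_ :: _); rewrite /next_bit.
case: b h => /andP[h1 h2]; first by [].
by apply/negbTE; rewrite -ltNge; lra.
Qed.

Let word_left_ge0 s : (0 <= word_left s)%R.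
Proof.
elim: s => //= b s IHs; rewrite addr_ge0//; case: b => //.
Qed.

Let word_right_le1 s : (word_left s + gamma s <= 1)%R.
Proof.
elim: s => [|b s IHs] /=; first by rewrite gamma_nil add0r.
have g0 := gamma_ge0 (false :: s); have g1 := gamma_ge0 (true :: s).
by have gE := gamma_split s; case: b; lra.
Qed.

Let measurable_next_bit s : measurable [set t : borel R | next_bit t s].
Proof.
rewrite (_ : [set _ | _] =
  ~` `]-oo, (word_left s + gamma (false :: s))%R[%classic); last first.
  by apply/seteqP; split => t /=; rewrite in_itv/= /next_bit leNgt => /negP.
by apply: measurableC; apply: sub_sigma_algebra; exact: interval_open.
Qed.

Let measurable_word s : measurable [set t : borel R | word_at t (size s) = s].
Proof.
elim: s => [|b s IHs] /=.
  by rewrite (_ : [set _ | _] = setT) ?measurableT//; apply/seteqP; split.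
rewrite (_ : [set _ | _] = [set t : borel R | word_at t (size s) = s] `&`
  [set t : borel R | next_bit t s = b]); last first.
  apply/seteqP; split => t /= => [[be se]|[-> ->//]].
  by split => //; rewrite -be se.
apply: measurableI => //; case: b; first exact: measurable_next_bit.
rewrite (_ : [set _ | _] = ~` [set t : borel R | next_bit t s]).
  exact: measurableC.
by apply/seteqP; split => x /=; [move=> ->|move/negP/negbTE].
Qed.

Lemma measurable_random_bits : measurable_fun setT random_bits.
Proof.
apply: measurable_to_cantor => k.
rewrite (_ : [set _ | _] = \bigcup_s ([set t : borel R | word_at t k = s] `&`
   [set t : borel R | next_bit t s])); last first.
  apply/seteqP; split => t /=; first by exists (word_at t k).
  by move=> [s _ [/= <-]].
apply: countable_bigcupT_measurable => // s.
apply: measurableI => //; have [<-//|sk] := eqVneq (size s) k.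
rewrite (_ : [set _ | _] = set0) ?measurable0//; apply/seteqP; split => t //= ts.
have sizeE n : size (word_at t n) = n by elim: n => //= n ->.
by move: sk; rewrite -ts sizeE eqxx.
Qed.

Lemma unit_law_random_bits s :
  unit_law R [set t | bit_prefix (random_bits t) (size s) = s] = (gamma s)%:E.
Proof.
rewrite (@unit_law_itv R _ (word_left s) (word_left s + gamma s)).
- by rewrite addrAC subrr add0r.
- apply/seteqP; split => t /=; rewrite !in_itv/= bit_prefix_random_bits.
    by move=> [st t01]; apply/word_atP.
  move=> st; have t01 : (0 <= t < 1)%R.
    have := word_left_ge0 s; have := word_right_le1 s.
    by case/andP: st => h1 h2 h3 h4; apply/andP; split; lra.
  by split => //; apply/word_atP.
- by rewrite lerDl.
Qed.

End bit_tree.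

(** * Gluing a sequence of couplings *)

Section cantor_pairs.
Context (R : realType).

Lemma cylinder_cat l l' : cylinder l `&` cylinder l' = cylinder (l ++ l').
Proof.
apply/seteqP; split => b; rewrite /cylinder/= all_cat.
  by move=> [-> ->].
by move=> /andP[].
Qed.

Lemma cylinder_nil : cylinder [::] = setT.
Proof. by apply/seteqP; split. Qed.

Let rectangles : set (set (cantor * cantor)) :=
  [set A `*` B | A in range cylinder & B in range cylinder].

(* Both projections are measurable for the sigma-algebra of the rectangles,
   hence so is the identity. *)
Let rectangles_generate : @measurable _ (cantor * cantor)%type = <<s rectangles >>.
Proof.
apply/seteqP; split => A.
  pose S := g_sigma_algebraType rectangles.
  have mfst : measurable_fun setT (fst : S -> cantor).
    move=> _ B; rewrite setTI; apply: measurable_preimage_generated => {}B [l _ <-].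
    apply: sub_sigma_algebra; exists (cylinder l); first by exists l.
    exists setT; first by exists [::] => //; exact: cylinder_nil.
    by apply/seteqP; split => x //= [].
  have msnd : measurable_fun setT (snd : S -> cantor).
    move=> _ B; rewrite setTI; apply: measurable_preimage_generated => {}B [l _ <-].
    apply: sub_sigma_algebra; exists setT; first by exists [::] => //; exact: cylinder_nil.
    exists (cylinder l); first by exists l.
    by apply/seteqP; split => x //= [].
  have := measurable_fun_pair mfst msnd => mid mA.
  have := mid measurableT A mA; rewrite setTI; congr (<<s _ >> _).
  by apply/seteqP; split => -[].
apply: (@measurable_preimage_generated _ (cantor * cantor)%type _ rectangles idfun).
move=> _ [_ [l _ <-] [_ [l' _ <-] <-]].
by apply: measurableX; apply: sub_sigma_algebra; [exists l|exists l'].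
Qed.

Lemma cantor_pair_unique (m1 m2 : probability (cantor * cantor)%type R) :
  (forall l l', m1 (cylinder l `*` cylinder l') = m2 (cylinder l `*` cylinder l')) ->
  forall A, measurable A -> m1 A = m2 A.
Proof.
move=> m12 A mA.
apply: (@measure_unique _ R (cantor * cantor)%type rectangles (fun _ => setT)) => //.
- move=> _ _ [_ [l1 _ <-] [_ [l1' _ <-] <-]] [_ [l2 _ <-] [_ [l2' _ <-] <-]].
  rewrite /rectangles /=; exists (cylinder (l1 ++ l2)); first by exists (l1 ++ l2).
  exists (cylinder (l1' ++ l2')); first by exists (l1' ++ l2').
  by rewrite -!cylinder_cat; apply/seteqP; split => x /= [[? ?] [? ?]].
- move=> n; exists setT; first by exists [::] => //; exact: cylinder_nil.
  by exists setT; [exists [::] => //; exact: cylinder_nil|rewrite setXTT].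
- by rewrite bigcup_const//; exists 0%N.
- move=> _ [_ [l _ <-] [_ [l' _ <-] <-]]; exact: m12.
- by move=> n; rewrite [X in X < _](probability_setT m1) ltry.
Qed.

End cantor_pairs.

Lemma nat_pairing : exists (e : nat -> nat * nat) (r : nat * nat -> nat),
  cancel e r /\ cancel r e.
Proof.
have /card_set_bijP[r] := card_nat2.
by rewrite setTT_bijective => -[e re er]; exists e, r.
Qed.

Section gluing.
Context (R : realType) (d : nat -> measure_display)
  (T : forall n, measurableType (d n)).
Variables (mu : forall n, probability (T n) R)
  (pi : forall n, probability (T n * T n.+1)%type R).
Hypotheses (pi_fst : forall n, has_law (pi n) fst (mu n))
  (pi_snd : forall n, has_law (pi n) snd (mu n.+1)).
Variables (c : forall n, T n -> cantor) (g : forall n, cantor -> T n).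
Hypotheses (mc : forall n, measurable_fun setT (@c n))
  (mg : forall n, measurable_fun setT (@g n)) (cK : forall n, cancel (@c n) (@g n)).
Variables (e : nat -> nat * nat) (r : nat * nat -> nat).
Hypotheses (eK : cancel e r) (rK : cancel r e).

(** [((n, i), v)] asks the [i]-th bit of the [n]-th point to be [v]. *)
Definition constraint : Type := ((nat * nat) * bool)%type.
Implicit Types (L : seq constraint) (q : constraint).

Definition family_of L (n : nat) : set (T n) :=
  [set x | all (fun q : constraint => (q.1.1 == n) ==> (c x q.1.2 == q.2)) L].
Arguments family_of L n : clear implicits.

(* Beyond the largest point index, a system imposes no condition, and the mass
   of the chain no longer changes. *)
Let level L := (\max_(q <- L) q.1.1)%N.

Definition glued_mass L : \bar R := chain_mass mu pi (family_of L) (level L).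

Let measurable_family L n : measurable (family_of L n).
Proof.
elim: L => [|q L IHL].
  by rewrite (_ : family_of _ _ = setT) ?measurableT//; apply/seteqP; split.
rewrite (_ : family_of _ _ = [set x | (q.1.1 == n) ==> (c x q.1.2 == q.2)] `&`
  family_of L n).
  apply: measurableI => //; case: eqVneq => /= _; last first.
    by rewrite (_ : [set _ | _] = setT) ?measurableT//; apply/seteqP; split.
  rewrite (_ : [set _ | _] = @c n @^-1` [set b : cantor | b q.1.2 = q.2]).
    by rewrite -[X in measurable X]setTI; apply: mc => //; exact: measurable_bit.
  by apply/seteqP; split => x /= /eqP.
by apply/seteqP; split => x /=; rewrite /family_of/= => /andP.
Qed.

Let level_mem L q : q \in L -> (q.1.1 <= level L)%N.
Proof. by move=> qL; rewrite /level (big_rem q)//= leq_maxl. Qed.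

Let glued_massE L n : (level L <= n)%N ->
  chain_mass mu pi (family_of L) n = glued_mass L.
Proof.
rewrite /glued_mass; elim: n => [|n IHn].
  by rewrite leqn0 => /eqP ->.
rewrite leq_eqVlt => /orP[/eqP <-//|]; rewrite ltnS => Ln.
rewrite chain_mass_stable ?IHn//.
apply/seteqP; split => x // _; apply/allP => q /level_mem qL /=.
by apply/implyP => /eqP qn; move: qL; rewrite qn leqNgt ltnS Ln.
Qed.

Let eq_glued_mass L L' : family_of L = family_of L' ->
  glued_mass L = glued_mass L'.
Proof.
move=> LL'; rewrite -(glued_massE (leq_maxl (level L) (level L'))) LL'.
by rewrite glued_massE// leq_maxr.
Qed.

Let glued_mass_split L p :
  glued_mass L = glued_mass ((p, false) :: L) + glued_mass ((p, true) :: L).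
Proof.
pose m := maxn p.1 (level L).
have levelE b : level ((p, b) :: L) = m by rewrite /level big_cons.
rewrite -(glued_massE (leq_maxr p.1 (level L))) -/m.
rewrite -(@glued_massE _ m) ?levelE// -(@glued_massE ((p, true) :: L) m) ?levelE//.
have other b i : i != p.1 -> family_of ((p, b) :: L) i = family_of L i.
  move=> ip; apply/seteqP; split => x; rewrite /family_of/= eq_sym (negbTE ip)//.
have mf L' : forall n, measurable (family_of L' n) := measurable_family L'.
apply: (chain_mass_split pi_fst pi_snd (mf _) (mf _) (mf _)
  (@other false) (@other true)).
- apply/seteqP; split => x; rewrite /family_of/= eqxx/=.
    by move=> [/andP[]|/andP[]].
  by move=> ->; rewrite !andbT; case: (c x p.2); [right|left].
- apply/seteqP; split => x //; rewrite /family_of/= eqxx/=.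
  by move=> [/andP[/eqP ->]].
- exact: leq_maxl.
Qed.

Let glued_mass_fin L : glued_mass L \is a fin_num.
Proof.
have [h0 mh hfin] := chain_density_finite pi_fst pi_snd (level L) (measurable_family L).
by rewrite ge0_fin_numE// integral_ge0.
Qed.

Let glued_mass_ge0 L : 0 <= glued_mass L.
Proof.
have [h0 mh hfin] := chain_density_finite pi_fst pi_snd (level L) (measurable_family L).
by apply: integral_ge0 => x _.
Qed.

(* Prescribing one more bit of a point that cannot exist changes nothing, so
   additivity gives [m = m + m]. *)
Let glued_mass_empty L n : family_of L n = set0 -> glued_mass L = 0.
Proof.
move=> Ln; have [p pn] : exists p : nat * nat, p.1 = n by exists (n, 0%N).
have pL b : family_of ((p, b) :: L) = family_of L.
  apply: functional_extensionality_dep => i.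
  apply/seteqP; split => x; rewrite /family_of/=;
    [by move=> /andP[]|move=> xL].
  have [pi_|] := eqVneq p.1 i; last by [].
  move: xL; subst i; move: Ln; rewrite -pn => Ln xL.
  by have : family_of L p.1 x by []; rewrite Ln.
have := glued_mass_split L p; rewrite !(eq_glued_mass (pL _)).
rewrite -(fineK (glued_mass_fin L)) -EFinD => -[] /eqP.
by rewrite -subr_eq subrr => /eqP <-.
Qed.

(** The conditions saying that the bits listed by [e] begin with the reversal
    of [s]. *)
Fixpoint literals (s : seq bool) : seq constraint :=
  if s is b :: s' then (e (size s'), b) :: literals s' else [::].

Let gamma (s : seq bool) : R := fine (glued_mass (literals s)).

Let gamma_nil : gamma [::] = 1%R.
Proof.
rewrite /gamma /= /glued_mass /level big_nil /chain_mass/=.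
rewrite (eq_integral (cst 1)); last by move=> x _; rewrite indicE mem_set.
by rewrite integral_cst// mul1e [X in fine X](probability_setT (mu 0)).
Qed.

Let gamma_ge0 s : (0 <= gamma s)%R.
Proof. exact: fine_ge0. Qed.

Let gamma_split s : gamma s = (gamma (false :: s) + gamma (true :: s))%R.
Proof. by rewrite /gamma (glued_mass_split _ (e (size s))) fineD. Qed.

Let bits : borel R -> cantor := random_bits gamma.

Let measurable_bits : measurable_fun setT bits.
Proof. exact: measurable_random_bits. Qed.

Definition event L : set (borel R) :=
  [set t | all (fun q : constraint => bits t (r q.1) == q.2) L].

Let measurable_event L : measurable (event L).
Proof.
rewrite (_ : event L = bits @^-1` cylinder [seq (r q.1, q.2) | q <- L]).
  rewrite -[X in measurable X]setTI; apply: measurable_bits => //.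
  by apply: sub_sigma_algebra; eexists.
by apply/seteqP; split => t; rewrite /event /cylinder /= all_map.
Qed.

Let event_literals s : event (literals s) = [set t | bit_prefix (bits t) (size s) = s].
Proof.
apply/seteqP; split => t; rewrite /event/=; elim: s => //= b s IHs.
  by rewrite eK => /andP[/eqP -> /IHs ->].
by move=> [<- /IHs ->]; rewrite eK eqxx.
Qed.

Let unit_event_split L p :
  unit_law R (event L) =
  unit_law R (event ((p, false) :: L)) + unit_law R (event ((p, true) :: L)).
Proof.
rewrite -measureU//.
  congr (unit_law R _); apply/seteqP; split => t; rewrite /event/=.
    by move=> ->; rewrite !andbT; case: (bits t _); [right|left].
  by move=> [/andP[]|/andP[]].
by apply/seteqP; split => t //; rewrite /event/= => -[/andP[/eqP ->]].
Qed.

Let literals_complete s k : (k < size s)%N ->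
  (e k, true) \in literals s \/ (e k, false) \in literals s.
Proof.
elim: s => //= b s IHs; rewrite ltnS leq_eqVlt => /orP[/eqP ->|/IHs[]h].
- by rewrite !inE; case: b; [left|right]; rewrite eqxx.
- by left; rewrite inE h orbT.
- by right; rewrite inE h orbT.
Qed.

(* Both sides are additive in the constraints, so they agree as soon as they
   agree once enough further bits are prescribed. When all the bits up to the
   largest one in [L] are prescribed by a word [s], either [L] repeats part of
   [s], and the equality is that of the interval of [s], or it contradicts
   [s], and both sides vanish. *)
Let unit_event L : unit_law R (event L) = glued_mass L.
Proof.
pose N := (\max_(q <- L) (r q.1).+1)%N.
have LN q : q \in L -> (r q.1 < N)%N.
  by move=> qL; rewrite /N (big_rem q)//= leq_max ltnSn.
suff H k s : (size s + k)%N = N ->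
    unit_law R (event (L ++ literals s)) = glued_mass (L ++ literals s).
  by have := H N [::] (add0n _); rewrite cats0.
elim: k s => [|k IHk] s sN.
  rewrite addn0 in sN.
  have [Ls|/allPn[q qL qs]] := boolP (all (mem (literals s)) L).
    have redundant (a : pred constraint) : all a (L ++ literals s) = all a (literals s).
      rewrite all_cat andbC; case: (boolP (all a (literals s))) => //= /allP as_.
      by apply/allP => q /(allP Ls) /as_.
    rewrite (_ : event _ = event (literals s)); last first.
      by apply/seteqP; split => t; rewrite /event/= redundant.
    rewrite (_ : glued_mass _ = glued_mass (literals s)); last first.
      apply: eq_glued_mass; apply: functional_extensionality_dep => n.
      by apply/seteqP; split => t; rewrite /family_of/= redundant.
    rewrite event_literals unit_law_random_bits//.
    by rewrite /gamma fineK.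
  have qs' : (q.1, ~~ q.2) \in literals s.
    have := @literals_complete s (r q.1); rewrite sN LN// => /(_ isT).
    move: qs; rewrite rK; case: q {qL} => p [] /= /negbTE; first by move=> -> [].
    by move=> -> [].
  rewrite (_ : event _ = set0) ?measure0.
    rewrite (@glued_mass_empty _ q.1.1)//; apply/seteqP; split => x //.
    rewrite /family_of/= all_cat => /andP[/allP/(_ _ qL) + /allP/(_ _ qs')] /=.
    by rewrite eqxx/= => /eqP ->; case: (q.2).
  apply/seteqP; split => x //.
  rewrite /event/= all_cat => /andP[/allP/(_ _ qL) + /allP/(_ _ qs')] /=.
  by move=> /eqP ->; case: (q.2).
rewrite (unit_event_split _ (e (size s))) (glued_mass_split _ (e (size s))).
have reorder (a : pred constraint) b : all a ((e (size s), b) :: L ++ literals s) =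
    all a (L ++ literals (b :: s)).
  by rewrite /= !all_cat/= andbCA.
have sS b : (size (b :: s) + k)%N = N by rewrite /= addSn -addnS.
have ev b : event ((e (size s), b) :: L ++ literals s) = event (L ++ literals (b :: s)).
  by rewrite /event; apply/seteqP; split => t; rewrite /= -/(literals (b :: s)) -reorder.
have gm b : glued_mass ((e (size s), b) :: L ++ literals s) =
    glued_mass (L ++ literals (b :: s)).
  apply: eq_glued_mass; apply: functional_extensionality_dep => n.
  by rewrite /family_of; apply/seteqP; split => t; rewrite /= -/(literals (b :: s)) -reorder.
by rewrite !ev !gm !IHk.
Qed.

Let glued_bits n (t : borel R) : cantor := fun i => bits t (r (n, i)).

Let measurable_glued_bits n : measurable_fun setT (glued_bits n).
Proof.
apply: measurable_to_cantor => i.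
have := measurable_bits measurableT (measurable_bit (r (n, i)) true).
by rewrite setTI.
Qed.

Let glued_bits_pair n : has_law (unit_law R)
  (fun t => (glued_bits n t, glued_bits n.+1 t))
  (image_probability (pi n) (measurable_fun_pair
    (measurableT_comp (@mc n) measurable_fst)
    (measurableT_comp (@mc n.+1) measurable_snd))).
Proof.
have mpair : measurable_fun setT (fun t => (glued_bits n t, glued_bits n.+1 t)).
  exact: measurable_fun_pair.
split => //.
apply: (cantor_pair_unique (m1 := image_probability (unit_law R) mpair)) => l l'.
pose L := [seq ((n, z.1), z.2) | z <- l] ++ [seq ((n.+1, z.1), z.2) | z <- l'].
transitivity (unit_law R (event L)).
  rewrite /= /image_law; congr (unit_law R _).
  apply/seteqP; split => t; rewrite /event /L /cylinder /= all_cat !all_map.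
    by move=> [-> ->].
  by move=> /andP[].
rewrite unit_event -(@glued_massE _ n.+1); last first.
  rewrite /level big_cat/= geq_max !big_map; apply/andP; split.
    by apply/bigmax_leqP_seq => i _ _ /=.
  by apply/bigmax_leqP_seq => i _ _ /=.
rewrite chain_mass_pair//; last first.
  move=> i iN; apply/seteqP; split => x // _.
  rewrite /family_of /L/= all_cat !all_map; apply/andP; split; apply/allP => q _ /=.
    by rewrite gtn_eqF.
  by rewrite gtn_eqF// ltnS ltnW.
have lE x : family_of L n x = cylinder l (c x).
  rewrite /family_of /cylinder /L /= all_cat !all_map; congr is_true.
  rewrite (@eq_all _ _ (fun z => c x z.1 == z.2)); last by move=> z /=; rewrite eqxx.
  by rewrite [X in _ && X](@eq_all _ _ predT) ?all_predT ?andbT// => z /=; rewrite gtn_eqF.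
have l'E y : family_of L n.+1 y = cylinder l' (c y).
  rewrite /family_of /cylinder /L /= all_cat !all_map; congr is_true.
  rewrite andbC (@eq_all _ _ (fun z => c y z.1 == z.2)); last by move=> z /=; rewrite eqxx.
  by rewrite [X in _ && X](@eq_all _ _ predT) ?all_predT ?andbT// => z /=; rewrite ltn_eqF.
rewrite /= /image_law; congr (pi n _); apply/seteqP; split => -[x y] /= [].
  by rewrite lE l'E.
by rewrite -lE -l'E.
Qed.

(** The two laws agree on pairs of cylinders after coding; decoding is a left
    inverse of the coding, so it turns this into the coupling itself. *)
Lemma glue_couplings : exists f : forall n, borel R -> T n,
  forall n, has_law (unit_law R) (fun t => (f n t, f n.+1 t)) (pi n).
Proof.
exists (fun n t => @g n (glued_bits n t)) => n.
have gg : has_law (image_probability (pi n) (measurable_fun_pair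
    (measurableT_comp (@mc n) measurable_fst)
    (measurableT_comp (@mc n.+1) measurable_snd)))
    (fun z => (@g n z.1, @g n.+1 z.2)) (pi n).
  split; first by apply: measurable_fun_pair; exact: measurableT_comp.
  move=> A mA; rewrite /= /image_law; congr (pi n _).
  by apply/seteqP; split => -[x y] /=; rewrite !cK.
exact: has_law_comp (glued_bits_pair n) gg.
Qed.

End gluing.

(** * Norms on probability spaces *)

Section norms.
Context (R : realType) d (T : measurableType d) (P : probability T R).
Implicit Types (f g : T -> R) (p : \bar R).

Let PT : (P : {measure set T -> \bar R}) setT = 1.
Proof. exact: probability_setT. Qed.

Lemma le_Lnorm_ae p f g : 1 <= p -> measurable_fun setT f ->
  measurable_fun setT g -> {ae P, forall x, (0 <= f x <= g x)%R} ->
  'N[P]_p[EFin \o f] <= 'N[P]_p[EFin \o g].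
Proof.
move=> p1 mf mg fg; rewrite unlock; case: p p1 => [r|_|//].
  rewrite lee_fin => r1; have r0 : (0 < r)%R by exact: lt_le_trans r1.
  have mpow (h : T -> R) : measurable_fun setT h ->
      measurable_fun setT (fun x => `|(EFin \o h) x| `^ r).
    move=> mh; apply: (measurableT_comp (measurable_poweR r)).
    by apply: measurableT_comp => //; exact/measurable_EFinP.
  apply: gt0_ler_poweR; first by rewrite invr_ge0 ltW.
  - by rewrite in_itv/= leey andbT integral_ge0// => x _; exact: poweR_ge0.
  - by rewrite in_itv/= leey andbT integral_ge0// => x _; exact: poweR_ge0.
  apply: ae_ge0_le_integral => //.
  - by move=> x _; exact: poweR_ge0.
  - exact: mpow.
  - by move=> x _; exact: poweR_ge0.
  - exact: mpow.
  apply: filterS fg => x /andP[f0 fgx] _ /=; have g0 := le_trans f0 fgx.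
  rewrite lee_fin; apply: ge0_ler_powR; rewrite ?nnegrE//; first exact: ltW.
  by rewrite !ger0_norm.
rewrite PT lte01; apply: le_ess_sup; apply: filterS fg => x /andP[f0 fgx] /=.
by have g0 := le_trans f0 fgx; rewrite lee_fin !ger0_norm.
Qed.

Lemma Lnorm_cst p (a : R) : 1 <= p -> 'N[P]_p[cst a%:E] = `|a|%:E.
Proof.
rewrite unlock; case: p => [r|_|//].
  rewrite lee_fin => r1; have r0 : (0 < r)%R by exact: lt_le_trans r1.
  rewrite integral_cst// PT mule1 poweR_EFin -powRrM divff ?gt_eqF//.
  by rewrite powRr1.
rewrite PT lte01 (_ : abse \o _ = cst `|a|%:E)//.
by rewrite ess_sup_cst// PT.
Qed.

(** Hoelder against the constant [1], which has norm [1] for every exponent. *)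
Lemma Lnorm1_le p f : 1 <= p -> measurable_fun setT f ->
  'N[P]_1[EFin \o f] <= 'N[P]_p[EFin \o f].
Proof.
move=> p1 mf; case: p p1 => [r|_|//].
  rewrite lee_fin le_eqVlt => /predU1P[<-//|r1].
  have r0 : (0 < r)%R by exact: lt_trans r1.
  pose q := (1 - r^-1)^-1%R.
  have q0 : (0 < q)%R by rewrite invr_gt0 subr_gt0 invf_lt1.
  have := @hoelder _ _ _ P f (cst 1%R) r q mf (@measurable_cst _ _ _ _ _ _) r0 q0.
  rewrite /q invrK addrC subrK => /(_ erefl).
  rewrite (@Lnorm_cst q%:E 1%R); last first.
    by rewrite lee_fin invf_ge1 ?gerBl ?invr_ge0 ?ltW// subr_gt0 invf_lt1.
  by rewrite normr1 mule1; under eq_Lnorm do rewrite /= mulr1.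
rewrite Lnorm1 unlock PT lte01.
set M := ess_sup _ _.
apply: (@le_trans _ _ (\int[P]_x (cst M) x)).
  have M0 : 0 <= M.
    by apply: ess_sup_gee; [rewrite PT|apply: nearW => x /=; rewrite lee_fin].
  apply: ae_ge0_le_integral => //.
  - by apply: measurableT_comp => //; exact/measurable_EFinP.
  - by apply: filterS (ess_sup_ge P (abse \o (EFin \o f))) => x /= h _.
by rewrite integral_cst// PT mule1.
Qed.

Lemma le_limn_einf (u : nat -> \bar R) (a : \bar R) :
  (exists N, forall n, (N <= n)%N -> a <= u n) -> a <= limn_einf u.
Proof.
move=> [N hN]; rewrite limn_einf_lim.
apply: lime_ge; first exact: is_cvg_einfs.
exists N => // n /= Nn; apply: le_ereal_inf_tmp => _ [m /= nm <-].
by apply: hN; exact: leq_trans nm.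
Qed.

(** Fatou for all exponents at once. Only the upper bound that convergence puts
    on [H] matters; for finite [p] it passes to powers by monotonicity, by
    comparing roots of numbers below the limit. *)
Lemma Lnorm_fatou p (h : nat -> T -> R) (H : T -> R) (C : \bar R) : 1 <= p ->
  (forall n, measurable_fun setT (h n)) -> measurable_fun setT H ->
  (forall n x, (0 <= h n x)%R) -> (forall x, (0 <= H x)%R) ->
  {ae P, forall x, forall e : R, (0 < e)%R ->
    exists N, forall n, (N <= n)%N -> (H x <= h n x + e)%R} ->
  (forall n, 'N[P]_p[EFin \o h n] <= C) -> 'N[P]_p[EFin \o H] <= C.
Proof.
move=> p1 mh mH h0 H0 hH hC; case: p p1 hC => [r|_|//].
  rewrite lee_fin => r1 hC; have r0 : (0 < r)%R by exact: lt_le_trans r1.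
  have C0 : 0 <= C := le_trans (Lnorm_ge0 _ _ _) (hC 0%N).
  have mpow (g : T -> R) : measurable_fun setT g ->
      measurable_fun setT (fun x => `|(EFin \o g) x| `^ r).
    move=> mg; apply: (measurableT_comp (measurable_poweR r)).
    by apply: measurableT_comp => //; exact/measurable_EFinP.
  have powC (g : T -> R) : 'N[P]_r%:E[EFin \o g] <= C <->
      \int[P]_x (`|(EFin \o g) x| `^ r) <= C `^ r.
    rewrite unlock; set I := \int[P]_x _.
    have I0 : 0 <= I by apply: integral_ge0 => x _; exact: poweR_ge0.
    split => [IC|IC].
      have : (I `^ r^-1) `^ r <= C `^ r.
        apply: gt0_ler_poweR => //; first exact: ltW.
          by rewrite in_itv/= leey poweR_ge0.
        by rewrite in_itv/= leey C0.
      by rewrite -poweRrM mulVf ?gt_eqF// poweRe1.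
    have : I `^ r^-1 <= (C `^ r) `^ r^-1.
      apply: gt0_ler_poweR => //; first by rewrite invr_ge0 ltW.
        by rewrite in_itv/= leey I0.
      by rewrite in_itv/= leey poweR_ge0.
    by rewrite -poweRrM divff ?gt_eqF// poweRe1.
  apply/powC.
  apply: (@le_trans _ _ (\int[P]_x limn_einf (fun n => `|(EFin \o h n) x| `^ r))).
    apply: ae_ge0_le_integral => //.
    - by move=> x _; exact: poweR_ge0.
    - exact: mpow.
    - move=> x _; apply: le_limn_einf; exists 0%N => n _; exact: poweR_ge0.
    - apply: (measurableT_comp (@oppe_measurable R setT)) => //.
      apply: (@measurable_fun_limn_esup _ _ _ setT
        (fun n x => - (`|(EFin \o h n) x| `^ r))) => n.
      by apply: (measurableT_comp (@oppe_measurable R setT)) => //; exact: mpow.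
    apply: filterS hH => x hHx _.
    rewrite leNgt; apply/negP => /=.
    set L := limn_einf _.
    have L0 : 0 <= L by apply: le_limn_einf; exists 0%N => n _; rewrite lee_fin powR_ge0.
    case EL : L L0 => [l| |]//; rewrite lee_fin => l0; rewrite lte_fin ger0_norm//.
    (* [a] lies strictly between the lower limit and the power of [H x]; its
       root is below [H x], hence eventually below [h n x]. *)
    move=> lH; pose a := ((l + H x `^ r) / 2)%R.
    have la : (l < a)%R by rewrite midf_lt.
    have aH : (a < H x `^ r)%R by rewrite midf_lt.
    have a0 : (0 < a)%R by exact: le_lt_trans la.
    have bH : (a `^ r^-1 < H x)%R.
      rewrite ltNge; apply/negP => Hb; move: aH; rewrite ltNge => /negP; apply.
      apply: le_trans (ge0_ler_powR (ltW r0) _ _ Hb) _; rewrite ?nnegrE ?powR_ge0//.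
      by rewrite -powRrM mulVf ?gt_eqF// powRr1// ltW.
    have [|N hN] := hHx (H x - a `^ r^-1)%R; first by rewrite subr_gt0.
    suff : a%:E <= L by rewrite EL lee_fin leNgt la.
    apply: le_limn_einf; exists N => n /hN hn; rewrite lee_fin.
    have bh : (a `^ r^-1 <= h n x)%R by lra.
    rewrite ger0_norm//; apply: le_trans (ge0_ler_powR (ltW r0) _ _ bh).
      by rewrite -powRrM mulVf ?gt_eqF// powRr1// ltW.
      by rewrite nnegrE powR_ge0.
    by rewrite nnegrE.
  have := @fatou _ T R P setT measurableT (fun n x => `|(EFin \o h n) x| `^ r)
    (fun n => mpow _ (mh n)) (fun n x _ => poweR_ge0 _ _).
  move=> /le_trans; apply.
  rewrite limn_einf_lim; apply: lime_le; first exact: is_cvg_einfs.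
  apply: nearW => n; apply: (@le_trans _ _ (\int[P]_x (`|(EFin \o h n) x| `^ r))).
    by apply: ereal_inf_lbound; exists n => /=.
  by apply/powC.
rewrite unlock PT lte01 => hC; apply/ess_supP.
have hCae : {ae P, forall x, forall n, (h n x)%:E <= C}.
  apply/ae_foralln => n; have /ess_supP := hC n.
  by apply: filterS => x /=; rewrite ger0_norm.
apply: filterS2 hH hCae => x hHx hCx /=; rewrite ger0_norm//.
apply/lee_addgt0Pr => e e0; have [N /(_ N (leqnn N)) hN] := hHx e e0.
apply: (@le_trans _ _ ((h N x)%:E + e%:E)); first by rewrite -EFinD lee_fin.
exact: leeD.
Qed.

End norms.

Section summable_increments.
Context (R : realType) (Z : metricType R).

Lemma mdist_le_sum (u : nat -> Z) (N j : nat) :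
  (mdist (u N) (u (N + j)%N))%:E <=
  \sum_(N <= k < (N + j)%N) (mdist (u k) (u k.+1))%:E.
Proof.
elim: j => [|j IHj]; first by rewrite addn0 mdistxx big_geq.
rewrite addnS big_nat_recr/=; last exact: leq_addr.
apply: (@le_trans _ _ ((mdist (u N) (u (N + j)%N))%:E +
  (mdist (u (N + j)%N) (u (N + j).+1))%:E)).
  by rewrite -EFinD lee_fin metric_triangle.
by rewrite leeD.
Qed.

Lemma nneseries_tail_lt (h : nat -> R) : (forall k, (0 <= h k)%R) ->
  \sum_(0 <= k <oo) (h k)%:E < +oo -> forall e : R, (0 < e)%R ->
  exists N, forall m, \sum_(N <= k < m) (h k)%:E < e%:E.
Proof.
move=> h0 sfin e e0; have h0' k : xpredT k -> 0 <= (h k)%:E by rewrite lee_fin.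
have nb : nbhs (0 : \bar R) [set y | y < e%:E].
  by apply: open_nbhs_nbhs; split; [exact: open_ereal_lt_ereal|rewrite /= lte_fin].
have [N _ /(_ N (leqnn N)) tailN] := nneseries_tail_cvg sfin h0' nb.
exists N => m; apply: le_lt_trans tailN.
by apply: nneseries_lim_ge => k _; exact: h0'.
Qed.

Lemma mcauchy_summable (u : nat -> Z) :
  \sum_(0 <= k <oo) (mdist (u k) (u k.+1))%:E < +oo -> mcauchy u.
Proof.
move=> sfin e e0; have e20 : (0 < e / 2)%R by rewrite divr_gt0.
have [N hN] := nneseries_tail_lt (fun k => mdist_ge0 _ _) sfin e20.
have near_N m : (N <= m)%N -> (mdist (u N) (u m) < e / 2)%R.
  move=> Nm; rewrite -lte_fin; apply: le_lt_trans (hN m).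
  by rewrite -{1 2}(subnKC Nm); exact: mdist_le_sum.
exists N => m n /near_N hm /near_N hn.
by have := metric_triangle (u m) (u N) (u n); rewrite (metric_sym (u m) (u N)); lra.
Qed.

End summable_increments.

Section summable_norms.
Context (R : realType) d (T : measurableType d) (P : probability T R).

(** On a probability space all norms dominate the integral, so the sum has a
    finite integral. *)
Lemma ae_summable (p : \bar R) (h : nat -> T -> R) : 1 <= p ->
  (forall k, measurable_fun setT (h k)) -> (forall k x, (0 <= h k x)%R) ->
  \sum_(0 <= k <oo) 'N[P]_p[EFin \o h k] < +oo ->
  {ae P, forall x, \sum_(0 <= k <oo) (h k x)%:E < +oo}.
Proof.
move=> p1 mh h0 sfin.
have mh' k : measurable_fun setT (EFin \o h k) by exact/measurable_EFinP.
have h0' k x : 0 <= (EFin \o h k) x by rewrite lee_fin.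
have mS : measurable_fun setT (fun x => \sum_(0 <= k <oo) (EFin \o h k) x).
  exact: ge0_emeasurable_sum.
have S0 x : 0 <= \sum_(0 <= k <oo) (EFin \o h k) x by exact: nneseries_ge0.
have : P.-integrable setT (fun x => \sum_(0 <= k <oo) (EFin \o h k) x).
  apply/integrableP; split => //; under eq_integral do rewrite gee0_abs//.
  rewrite integral_nneseries//; apply: le_lt_trans sfin.
  apply: lee_nneseries => [k _ _|k _]; first exact: integral_ge0.
  apply: le_trans (Lnorm1_le _ p1 (mh k)).
  rewrite Lnorm1 le_eqVlt; apply/orP; left; apply/eqP; apply: eq_integral => x _.
  by rewrite /= ger0_norm.
move=> /(integrable_ae measurableT); apply: filterS => x /(_ I).
by rewrite -(ge0_fin_numE (S0 x)).
Qed.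

Lemma ae_exists (S : T -> Prop) : {ae P, forall x, S x} -> exists x, S x.
Proof.
move=> [N [mN PN SN]]; apply: contrapT => /forallNP nS.
have NT : N = setT by apply/seteqP; split => // x _; apply: SN; exact: nS.
by have := probability_setT P; rewrite -NT => /esym/eqP; rewrite PN onee_eq0.
Qed.

Lemma ae_mcauchy (Z : metricType R) (p : \bar R) (f : nat -> T -> Z) :
  separable Z -> 1 <= p -> (forall n, borel_measurable (f n)) ->
  \sum_(0 <= k <oo) 'N[P]_p[(fun x => (mdist (f k x) (f k.+1 x))%:E)] < +oo ->
  {ae P, forall x, mcauchy (f^~ x)}.
Proof.
move=> sZ p1 mf sfin.
have mh k : measurable_fun setT (fun x => mdist (f k x) (f k.+1 x)).
  exact: measurable_mdist.
have := ae_summable p1 mh (fun k x => mdist_ge0 _ _) sfin.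
by apply: filterS => x; exact: mcauchy_summable.
Qed.

End summable_norms.

(** * Gromov-Wasserstein distance *)

Section gromov_wasserstein_facts.
Context (R : realType) (Z : metricType R) (p : \bar R).
Hypotheses (sZ : separable Z) (p1 : 1 <= p).
Implicit Types X Y W : network Z p.

(** The kernel of [X] seen from a probability space through a random point of
    [X]: couplings are compared by pulling both kernels back to one space. *)
Definition pullback d (T : measurableType d) X (f : T -> borel X) : T * T -> Z :=
  fun q => ntw_omega (f q.1, f q.2).

Definition pullback_gap d (T : measurableType d) X Y (f : T -> borel X)
    (g : T -> borel Y) : T * T -> R :=
  fun q => mdist (pullback f q) (pullback g q).

Lemma borel_measurable_comp d d' (T : measurableType d) (T' : measurableType d')
    (h : T -> T') (f : T' -> Z) :
  measurable_fun setT h -> borel_measurable f -> borel_measurable (f \o h).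
Proof.
by move=> mh mf B mB; rewrite comp_preimage -[X in measurable X]setTI;
  apply: mh => //; exact: mf.
Qed.

Lemma measurable_pullback d (T : measurableType d) X (f : T -> borel X) :
  measurable_fun setT f -> borel_measurable (pullback f).
Proof.
move=> mf; apply: (borel_measurable_comp _ (@ntw_measurable _ _ _ X)).
by apply: measurable_fun_pair; exact: measurableT_comp.
Qed.

Lemma measurable_pullback_gap d (T : measurableType d) X Y (f : T -> borel X)
    (g : T -> borel Y) : measurable_fun setT f -> measurable_fun setT g ->
  measurable_fun setT (pullback_gap f g).
Proof. by move=> mf mg; apply: measurable_mdist => //; exact: measurable_pullback. Qed.

Lemma coupling_fst X Y pi : @coupling _ _ _ X Y pi -> has_law pi fst (ntw_mu X).
Proof. by move=> [h _]; split => //; exact: measurable_fst. Qed.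

Lemma coupling_snd X Y pi : @coupling _ _ _ X Y pi -> has_law pi snd (ntw_mu Y).
Proof. by move=> [_ h]; split => //; exact: measurable_snd. Qed.

(** The distortion of a coupling can be computed on any space where it is the
    joint law of two random points. *)
Lemma distortion_law d (T : measurableType d) (P : probability T R) X Y
    (f : T -> borel X) (g : T -> borel Y) (pi : probability (borel X * borel Y)%type R) :
  has_law P (fun t => (f t, g t)) pi ->
  'N[pi \x pi]_p[@distortion _ _ _ X Y] =
  'N[P \x P]_p[EFin \o pullback_gap f g].
Proof.
move=> fgpi; rewrite (has_law_Lnorm (has_law_prod fgpi fgpi) p1)//.
apply/measurable_EFinP; apply: measurable_pullback_gap.
  exact: measurable_fst.
exact: measurable_snd.
Qed.

Lemma GW_le_Lnorm d (T : measurableType d) (P : probability T R) X Y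
    (f : T -> borel X) (g : T -> borel Y) :
  has_law P f (ntw_mu X) -> has_law P g (ntw_mu Y) ->
  GW X Y <= (2^-1)%R%:E * 'N[P \x P]_p[EFin \o pullback_gap f g].
Proof.
move=> [mf fX] [mg gY]; have mfg := measurable_fun_pair mf mg.
rewrite /GW lee_pmul2l//; apply: ereal_inf_lbound.
exists (image_probability P mfg).
  by split => A mA; rewrite /pushforward /= /image_law -?fX -?gY.
exact: distortion_law (has_law_image P mfg).
Qed.

Lemma GW_lt_coupling X Y (e : R) : GW X Y < e%:E ->
  exists2 pi, @coupling _ _ _ X Y pi &
    'N[pi \x pi]_p[@distortion _ _ _ X Y] < (2 * e)%:E.
Proof.
rewrite /GW => h.
have : ereal_inf [set 'N[pi \x pi]_p[@distortion _ _ _ X Y] | pi in @coupling _ _ _ X Y]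
    < (2 * e)%:E.
  by rewrite EFinM -lte_pdivrMl.
by move=> /ereal_inf_lt[_ [pi cpi <-] lt_e]; exists pi.
Qed.

Lemma coding_network X : exists cg : (borel X -> cantor) * (cantor -> borel X),
  [/\ measurable_fun setT cg.1, measurable_fun setT cg.2 & cancel cg.1 cg.2].
Proof.
by have [c [g cg]] := polish_coding (@ntw_polish _ _ _ X); exists (c, g).
Qed.

Lemma glue_networks (X : nat -> network Z p)
    (pi : forall n, probability (borel (X n) * borel (X n.+1))%type R) :
  (forall n, coupling (pi n)) ->
  exists f : forall n, borel R -> borel (X n),
    forall n, has_law (unit_law R) (fun t => (f n t, f n.+1 t)) (pi n).
Proof.
move=> cpi; have [e [r [eK rK]]] := nat_pairing.
pose cg n := sval (cid (coding_network (X n))).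
have cgP n := svalP (cid (coding_network (X n))).
apply: (@glue_couplings _ _ _ (fun n => ntw_mu (X n)) pi _ _ (fun n => (cg n).1)
  (fun n => (cg n).2) _ _ _ e r eK rK).
- by move=> n; exact: coupling_fst (cpi n).
- by move=> n; exact: coupling_snd (cpi n).
- by move=> n; have [] := cgP n.
- by move=> n; have [] := cgP n.
- by move=> n; have [] := cgP n.
Qed.

Lemma product_coupling X Y : coupling (X := X) (Y := Y) (ntw_mu X \x ntw_mu Y).
Proof.
split => A mA.
  by have [_ h] := has_law_fst (ntw_mu X) (ntw_mu Y); exact: h.
by have [_ h] := has_law_snd (ntw_mu X) (ntw_mu Y); exact: h.
Qed.

(** Glue the two couplings by extending them to the infinite sequence
    [X, Y, W, W, ...]; then Minkowski applies to the three pulled back kernels.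
    The strict real bounds avoid subtracting infinite distances. *)
Lemma GW_triangle X Y W (a b : R) : GW X Y < a%:E -> GW Y W < b%:E ->
  GW X W < (a + b)%:E.
Proof.
move=> /GW_lt_coupling[pi1 cpi1 lt1] /GW_lt_coupling[pi2 cpi2 lt2].
pose N n := match n with 0%N => X | 1%N => Y | _ => W end.
pose pi : forall n, probability (borel (N n) * borel (N n.+1))%type R :=
  fun n => match n with 0%N => pi1 | 1%N => pi2 | _ => (ntw_mu W \x ntw_mu W) end.
have cpi n : coupling (pi n) by case: n => [|[|n]] //; exact: product_coupling.
have [f fpi] := glue_networks cpi.
have f0 := has_law_comp (fpi 0%N) (coupling_fst (cpi 0%N)).
have f1 := has_law_comp (fpi 1%N) (coupling_fst (cpi 1%N)).
have f2 := has_law_comp (fpi 1%N) (coupling_snd (cpi 1%N)).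
apply: le_lt_trans (GW_le_Lnorm f0 f2) _.
rewrite lte_pdivrMl// -EFinM mulrDr EFinD.
apply: (@le_lt_trans _ _ ('N[unit_law R \x unit_law R]_p[EFin \o pullback_gap (f 0%N) (f 1%N)] +
   'N[unit_law R \x unit_law R]_p[EFin \o pullback_gap (f 1%N) (f 2%N)])).
  have m01 := measurable_pullback_gap f0.1 f1.1.
  have m12 := measurable_pullback_gap f1.1 f2.1.
  have m02 := measurable_pullback_gap f0.1 f2.1.
  apply: le_trans (eminkowski _ m01 m12 p1).
  apply: le_Lnorm_ae => //; first exact: measurable_funD.
  by apply: nearW => q; rewrite mdist_ge0/= metric_triangle.
rewrite -(distortion_law (fpi 0%N)) -(distortion_law (fpi 1%N)).
exact: lteD.
Qed.

Lemma Lnorm_pullback_eq0 d (T : measurableType d) (P : probability T R) X Y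
    (f : T -> borel X) (g : T -> borel Y) :
  measurable_fun setT f -> measurable_fun setT g ->
  {ae P \x P, forall q, pullback f q = pullback g q} ->
  'N[P \x P]_p[EFin \o pullback_gap f g] = 0.
Proof.
move=> mf mg fg; apply/eqP; rewrite eq_le Lnorm_ge0 andbT.
apply: (@le_trans _ _ 'N[P \x P]_p[EFin \o cst 0%R]).
  apply: le_Lnorm_ae => //; first exact: measurable_pullback_gap.
  by apply: filterS fg => q fgq; rewrite /pullback_gap fgq mdistxx lexx.
rewrite [X in X <= _](_ : _ = 0)//; apply: Lnorm0.
by rewrite gt_eqF// (lt_le_trans _ p1).
Qed.

Lemma weak_iso_GW X Y : weak_iso X Y -> GW X Y <= 0.
Proof.
move=> [W [f [g [[mf mg] fX gY fg]]]].
have := GW_le_Lnorm (conj mf fX : has_law (ntw_mu W) f (ntw_mu X))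
  (conj mg gY : has_law (ntw_mu W) g (ntw_mu Y)).
rewrite Lnorm_pullback_eq0 ?mule0//.
by apply: filterS fg => q [qf qg]; exact: etrans (esym qf) qg.
Qed.

Lemma weak_iso_refl X : weak_iso X X.
Proof.
exists X, idfun, idfun; split => //.
  by split; exact: measurable_id.
by apply: nearW => q; rewrite -surjective_pairing.
Qed.

Definition class_of X : network_quotient Z p :=
  exist _ (weak_class X) (ex_intro _ X erefl).

(** Equal classes share their members, and every network belongs to its own
    class. *)
Lemma class_repr_iso X : weak_iso X (class_repr (class_of X)) /\
  weak_iso (class_repr (class_of X)) X.
Proof.
rewrite /class_repr; case: cid => Y /= XY; have XYE W : weak_iso X W = weak_iso Y W.
  by move: (congr1 (@^~ W) XY).
by split; [rewrite XYE|rewrite -XYE]; exact: weak_iso_refl.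
Qed.

End gromov_wasserstein_facts.

(** * Completeness *)

Section completeness.
Context (R : realType).

Lemma polish_real : polish R R.
Proof.
split.
  exists (range (@ratr R)); last exact: dense_rat.
  exact: sub_countable (card_image_le _ _) (countableP _).
exists R^o; split; last by exists idfun, idfun; split => // x; exact: cvg_id.
move=> u cu.
have cu' : cauchy ((u : nat -> R) @ \oo).
  apply: cauchy_exP => e e0; have [N hN] := cu e e0; exists (u N).
  by exists N => // n /= Nn; rewrite /ball/= distrC -lte_fin; exact: hN.
have [l ul] : exists l : R, (u : nat -> R) @ \oo --> l.
  by apply/cvg_ex; exact: R_complete.
exists l => e e0; move/cvgrPdist_lt : ul => /(_ e e0)[N _ hN].
by exists N => n Nn; rewrite lte_fin; exact: hN.
Qed.

Context (Z : metricType R) (p : \bar R).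
Hypotheses (sZ : separable Z) (p1 : 1 <= p).

Section real_network.
Variables (F : borel R * borel R -> Z) (mF : borel_measurable F)
  (finF : exists z0, 'N[unit_law R \x unit_law R]_p[(fun x => (mdist (F x) z0)%:E)] < +oo).

Definition real_network : network Z p :=
  @Network R Z p R polish_real (unit_law R) F mF finF.

Lemma has_law_real_network : has_law (unit_law R) idfun (ntw_mu real_network).
Proof. by split => //; exact: measurable_id. Qed.

End real_network.

Lemma borel_measurable_cst d (T : measurableType d) (z : Z) :
  borel_measurable (fun _ : T => z).
Proof.
move=> B _; have [Bz|Bz] := pselect (B z).
  by rewrite (_ : _ @^-1` _ = setT) ?measurableT//; apply/seteqP; split.
by rewrite (_ : _ @^-1` _ = set0) ?measurable0//; apply/seteqP; split.
Qed.

Lemma Lnorm_cst_mdist d (T : measurableType d) (P : probability T R) (z z' : Z) :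
  'N[P]_p[(fun _ => (mdist z z')%:E)] = (mdist z z')%:E.
Proof. by rewrite (Lnorm_cst P _ p1) ger0_norm// mdist_ge0. Qed.

Lemma cst_network_finite (z : Z) : exists z0,
  'N[unit_law R \x unit_law R]_p[(fun=> (mdist z z0)%:E)] < +oo.
Proof. by exists z; rewrite Lnorm_cst_mdist ltry. Qed.

Definition cst_network (z : Z) : network Z p :=
  real_network (@borel_measurable_cst _ _ z) (cst_network_finite z).

Lemma GW_cst_network z z' : GW (cst_network z) (cst_network z') <= (mdist z z')%:E.
Proof.
have law t : has_law (unit_law R) idfun (ntw_mu (cst_network t)).
  exact: has_law_real_network.
have := @GW_le_Lnorm _ _ _ sZ p1 _ _ _ (cst_network z) (cst_network z') _ _
  (law z) (law z'); move=> /le_trans; apply.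
rewrite [X in _ * X](_ : _ = (mdist z z')%:E); last exact: Lnorm_cst_mdist.
rewrite -EFinM lee_fin; have := mdist_ge0 z z'; lra.
Qed.

(** The distance to a constant depends on the second point only, so the
    coupling disappears from the distortion. *)
Lemma GW_cst_network_lt (z : Z) (L : network Z p) (e : R) :
  GW (cst_network z) L < e%:E ->
  'N[ntw_mu L \x ntw_mu L]_p[(fun q => (mdist z (ntw_omega q))%:E)] < (2 * e)%:E.
Proof.
move=> /GW_lt_coupling[pi cpi]; apply: le_lt_trans.
have hs := coupling_snd cpi.
have mz : measurable_fun setT (fun q => (mdist z (@ntw_omega _ _ _ L q))%:E).
  apply/measurable_EFinP; apply: measurable_mdist => //.
    exact: borel_measurable_cst.
  exact: ntw_measurable.
by rewrite (has_law_Lnorm (has_law_prod hs hs) p1 mz).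
Qed.

Lemma half_pow_gt0 k : (0 < 1 / (2 ^ k)%:R :> R)%R.
Proof. by rewrite divr_gt0// ltr0n expn_gt0. Qed.

Lemma half_pow_lt (e : R) : (0 < e)%R -> exists k, (1 / (2 ^ k)%:R < e)%R.
Proof.
move=> e0; have [k _ hk] := near_infty_natSinv_lt (PosNum e0).
exists k; apply: le_lt_trans (hk k (leqnn k)); rewrite mul1r.
rewrite lef_pV2 ?posrE ?ltr0n ?expn_gt0// ler_nat.
exact: ltn_expl.
Qed.

(** The points converge to a value of the kernel of the limit network, taken at
    a pair where a fast subsequence converges. *)
Lemma complete_network_quotient_complete_metric :
  complete_dist (@GW_quotient R Z p) -> complete_metric Z.
Proof.
move=> cM z cz.
have {}cz : mcauchy z.
  move=> e e0; have [N hN] := cz e e0; exists N => m n Nm Nn.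
  by rewrite -lte_fin; exact: hN.
pose C n := class_of (cst_network (z n)).
have lt_e X Y (e : R) : weak_iso X Y -> (0 < e)%R -> @GW R Z p X Y < e%:E.
  by move=> XY e0; apply: le_lt_trans (weak_iso_GW sZ p1 XY) _; rewrite lte_fin.
have [|l hl] := cM C.
  move=> e e0; have e40 : (0 < e / 4)%R by rewrite divr_gt0.
  have [N hN] := cz _ e40; exists N => m n Nm Nn.
  have h1 := lt_e _ _ _ (class_repr_iso (cst_network (z m))).2 e40.
  have h2 : GW (cst_network (z m)) (cst_network (z n)) < (e / 4)%:E.
    by apply: le_lt_trans (GW_cst_network _ _) _; rewrite lte_fin hN.
  have h3 := lt_e _ _ _ (class_repr_iso (cst_network (z n))).1 e40.
  have := GW_triangle sZ p1 (GW_triangle sZ p1 h1 h2) h3.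
  by move=> /lt_le_trans; apply; rewrite lee_fin; lra.
set L := class_repr l in hl.
have near_L (e : R) : (0 < e)%R -> exists N, forall n, (N <= n)%N ->
    'N[ntw_mu L \x ntw_mu L]_p[(fun q => (mdist (z n) (ntw_omega q))%:E)] < e%:E.
  move=> e0; have e40 : (0 < e / 4)%R by rewrite divr_gt0.
  have [N hN] := hl _ e40; exists N => n /hN hn.
  have h1 := lt_e _ _ _ (class_repr_iso (cst_network (z n))).1 e40.
  have := GW_cst_network_lt (GW_triangle sZ p1 h1 hn).
  by move=> /lt_le_trans; apply; rewrite lee_fin; lra.
have /choice[N hN] : forall k, exists N, forall n, (N <= n)%N ->
    'N[ntw_mu L \x ntw_mu L]_p[(fun q => (mdist (z n) (ntw_omega q))%:E)]
      < (1 / (2 ^ k.+1)%:R)%:E.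
  by move=> k; exact: near_L (half_pow_gt0 k.+1).
(* Taking the maximum with [k] makes the indices unbounded. *)
pose M k := maxn k (N k).
have [w hw] : exists w, \sum_(0 <= k <oo)
    (mdist (z (M k)) (@ntw_omega _ _ _ L w))%:E < +oo.
  apply: (@ae_exists _ _ _ (ntw_mu L \x ntw_mu L)).
  apply: (ae_summable (h := fun k w => mdist (z (M k)) (ntw_omega w)) p1).
  - move=> k; apply: measurable_mdist => //; first exact: borel_measurable_cst.
    exact: ntw_measurable.
  - by move=> k x; exact: mdist_ge0.
  apply: (@le_lt_trans _ _ (\sum_(0 <= k <oo) (1 / (2 ^ k.+1)%:R)%:E)).
    apply: lee_nneseries => [k _ _|k _]; first exact: Lnorm_ge0.
    by apply/ltW/hN; exact: leq_maxr.
  by apply: le_lt_trans (epsilon_trick0 _ ler01) _; rewrite ltry.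
exists (ntw_omega w) => e e0; have e20 : (0 < e / 2)%R by rewrite divr_gt0.
have [K1 hK1] := nneseries_tail_lt (fun k => mdist_ge0 _ _) hw e20.
have [K2 hK2] := cz _ e20.
pose k := maxn K1 K2.
have zk : (mdist (z (M k)) (ntw_omega w) < e / 2)%R.
  rewrite -lte_fin; apply: le_lt_trans (hK1 k.+1).
  rewrite big_nat_recr/=; last exact: leq_maxl.
  by rewrite leeDr// sume_ge0// => i _; rewrite lee_fin mdist_ge0.
exists K2 => n K2n; rewrite lte_fin.
have := hK2 n (M k) K2n (leq_trans (leq_maxr K1 K2) (leq_maxl _ _)).
have := metric_triangle (z n) (z (M k)) (ntw_omega w).
lra.
Qed.

Lemma Lnorm_mdist_chain d (T : measurableType d) (P : probability T R)
    (g : nat -> T -> Z) : (forall n, borel_measurable (g n)) ->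
  (forall k, 'N[P]_p[(fun x => (mdist (g k x) (g k.+1 x))%:E)] <=
             (1 / (2 ^ k.+1)%:R)%:E) ->
  forall k j, 'N[P]_p[(fun x => (mdist (g k x) (g (k + j)%N x))%:E)] <=
    (1 / (2 ^ k)%:R - 1 / (2 ^ (k + j))%:R)%:E.
Proof.
move=> mg gk k; elim=> [|j IHj].
  rewrite addn0 subrr.
  rewrite (_ : (fun x => _) = EFin \o cst 0%R); last first.
    by apply/funext => x; rewrite mdistxx.
  by rewrite (Lnorm_cst P 0 p1) normr0.
have m1 := measurable_mdist sZ (mg k) (mg (k + j)%N).
have m2 := measurable_mdist sZ (mg (k + j)%N) (mg (k + j).+1).
have m3 := measurable_mdist sZ (mg k) (mg (k + j).+1).
rewrite addnS; apply: (@le_trans _ _ ((1 / (2 ^ k)%:R - 1 / (2 ^ (k + j))%:R)%:E +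
  (1 / (2 ^ (k + j).+1)%:R)%:E)).
  apply: le_trans (leeD IHj (gk (k + j)%N)).
  apply: le_trans (eminkowski P m1 m2 p1).
  apply: le_Lnorm_ae => //; first exact: measurable_funD.
  by apply: nearW => x; rewrite mdist_ge0/= metric_triangle.
rewrite -EFinD lee_fin expnS natrM.
have := half_pow_gt0 (k + j)%N; rewrite !mul1r invfM.
by move: (((2 ^ (k + j))%:R : R)^-1)%R => a a0; lra.
Qed.

(** The limit network carries the almost everywhere limit of the kernels pulled
    back to the space where all the couplings have been realized. *)
Lemma complete_metric_complete_network_quotient :
  complete_metric Z -> complete_dist (@GW_quotient R Z p).
Proof.
move=> cZ u cu; pose X n := class_repr (u n).
(* One power of two absorbs the factor [1/2] in the distance, so that the
   distortions add up to at most [1]. *)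
have /choice[N0 hN0] : forall k, exists N0, forall m n, (N0 <= m)%N -> (N0 <= n)%N ->
    GW (X m) (X n) < (1 / (2 ^ k.+2)%:R)%:E.
  by move=> k; exact: cu (half_pow_gt0 k.+2).
(* Partial sums make the chosen indices nondecreasing. *)
pose N k := (\sum_(i < k.+1) N0 i)%N.
have N0N k : (N0 k <= N k)%N by rewrite /N big_ord_recr/= leq_addl.
have NS k : (N k <= N k.+1)%N by rewrite /N [leqRHS]big_ord_recr/= leq_addr.
pose Y k := X (N k).
have Ylt k : GW (Y k) (Y k.+1) < (1 / (2 ^ k.+2)%:R)%:E.
  by apply: hN0; [exact: N0N|exact: leq_trans (N0N k) (NS k)].
pose pi k := s2val (cid2 (GW_lt_coupling (Ylt k))).
have cpi k : coupling (pi k) by exact: s2valP (cid2 (GW_lt_coupling (Ylt k))).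
have pilt k := s2valP' (cid2 (GW_lt_coupling (Ylt k))).
have [f fpi] := glue_networks cpi.
have flaw k : has_law (unit_law R) (f k) (ntw_mu (Y k)).
  exact: has_law_comp (fpi k) (coupling_fst (cpi k)).
pose PP := (unit_law R \x unit_law R)%E.
pose g k := pullback (f k).
have mg k : borel_measurable (g k) by apply: measurable_pullback; case: (flaw k).
have gk k : 'N[PP]_p[(fun x => (mdist (g k x) (g k.+1 x))%:E)] <=
    (1 / (2 ^ k.+1)%:R)%:E.
  have := pilt k; rewrite -/(pi k) (distortion_law sZ p1 (fpi k)) => /ltW.
  move=> /le_trans; apply; rewrite lee_fin [in leLHS]expnS natrM.
  have := half_pow_gt0 k.+1; rewrite !mul1r invfM.
  by move: (((2 ^ k.+1)%:R : R)^-1)%R => a a0; lra.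
have cg : {ae PP, forall x, mcauchy (g^~ x)}.
  apply: (ae_mcauchy sZ p1 mg).
  apply: (@le_lt_trans _ _ (\sum_(0 <= k <oo) (1 / (2 ^ k.+1)%:R)%:E)).
    by apply: lee_nneseries => [k _ _|k _]; [exact: Lnorm_ge0|exact: gk].
  by apply: le_lt_trans (epsilon_trick0 _ ler01) _; rewrite ltry.
have [F [mF hF]] := measurable_cauchy_limit sZ cZ mg.
have gF k : 'N[PP]_p[(fun x => (mdist (g k x) (F x))%:E)] <= (1 / (2 ^ k)%:R)%:E.
  (* The limit is controlled by the partial sums from [k] on. *)
  apply: (@Lnorm_fatou _ _ _ PP p (fun j x => mdist (g k x) (g (k + j)%N x))
    (fun x => mdist (g k x) (F x))) => //.
  - by move=> n; exact: measurable_mdist.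
  - exact: measurable_mdist.
  - by move=> n x; exact: mdist_ge0.
  - by move=> x; exact: mdist_ge0.
  - apply: filterS cg => x /hF gx e e0; have [M hM] := gx e e0.
    exists M => n Mn; apply: le_trans (metric_triangle _ (g (k + n)%N x) _) _.
    by rewrite lerD2l ltW// hM// (leq_trans Mn)// leq_addl.
  - move=> j; apply: le_trans (Lnorm_mdist_chain mg gk k j) _.
    by rewrite lee_fin gerBl ltW// half_pow_gt0.
have finF : exists z0, 'N[PP]_p[(fun x => (mdist (F x) z0)%:E)] < +oo.
  have [z0 hz0] := @ntw_finite _ _ _ (Y 0%N); exists z0.
  have mz : borel_measurable (fun _ : borel R * borel R => z0).
    exact: borel_measurable_cst.
  have m1 := measurable_mdist sZ (mg 0%N) mF.
  have m2 := measurable_mdist sZ (mg 0%N) mz.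
  have m3 := measurable_mdist sZ mF mz.
  apply: (@le_lt_trans _ _ ('N[PP]_p[(fun x => (mdist (g 0%N x) (F x))%:E)] +
     'N[PP]_p[(fun x => (mdist (g 0%N x) z0)%:E)])).
    apply: le_trans (eminkowski PP m1 m2 p1).
    apply: le_Lnorm_ae => //; first exact: measurable_funD.
    apply: nearW => x; rewrite mdist_ge0/= (metric_sym (g 0%N x) (F x)).
    exact: metric_triangle.
  apply: lte_add_pinfty; first by apply: le_lt_trans (gF 0%N) _; rewrite ltry.
  have mo : measurable_fun setT (fun q => (mdist (@ntw_omega _ _ _ (Y 0%N) q) z0)%:E).
    apply/measurable_EFinP; apply: measurable_mdist => //.
      exact: ntw_measurable.
    exact: borel_measurable_cst.
  by move: hz0; rewrite (has_law_Lnorm (has_law_prod (flaw 0%N) (flaw 0%N)) p1 mo).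
pose L := real_network mF finF.
have YL k : GW (Y k) L <= (1 / (2 ^ k.+1)%:R)%:E.
  have := @GW_le_Lnorm _ _ _ sZ p1 _ _ _ (Y k) L _ _ (flaw k)
    (has_law_real_network mF finF).
  move=> /le_trans; apply.
  rewrite (_ : EFin \o _ = (fun x => (mdist (g k x) (F x))%:E)); last first.
    by apply/funext => -[x y].
  apply: (@le_trans _ _ ((2^-1)%R%:E * (1 / (2 ^ k)%:R)%:E)).
    by rewrite lee_pmul2l.
  by rewrite -EFinM lee_fin expnS natrM !mul1r invfM.
exists (class_of L) => e e0.
have e30 : (0 < e / 3)%R by rewrite divr_gt0.
have [k hk] := half_pow_lt e30.
have hk1 : (1 / (2 ^ k.+1)%:R < e / 3)%R.
  apply: le_lt_trans hk; rewrite expnS natrM !mul1r invfM.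
  have := half_pow_gt0 k; rewrite mul1r.
  by move: (((2 ^ k)%:R : R)^-1)%R => a a0; lra.
have hk2 : (1 / (2 ^ k.+2)%:R < e / 3)%R.
  apply: le_lt_trans hk1; rewrite [in leLHS]expnS natrM !mul1r invfM.
  have := half_pow_gt0 k.+1; rewrite mul1r.
  by move: (((2 ^ k.+1)%:R : R)^-1)%R => a a0; lra.
exists (N k) => n Nn; rewrite /GW_quotient -/(X n).
have h1 : GW (X n) (Y k) < (e / 3)%:E.
  apply: lt_trans (hN0 k n (N k) (leq_trans (N0N k) Nn) (N0N k)) _.
  by rewrite lte_fin.
have h2 : GW (Y k) L < (e / 3)%:E by apply: le_lt_trans (YL k) _; rewrite lte_fin.
have h3 : GW L (class_repr (class_of L)) < (e / 3)%:E.
  by apply: le_lt_trans (weak_iso_GW sZ p1 (class_repr_iso L).1) _; rewrite lte_fin.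
have := GW_triangle sZ p1 (GW_triangle sZ p1 h1 h2) h3.
by move=> /lt_le_trans; apply; rewrite lee_fin; lra.
Qed.

End completeness.

Theorem theorem39 (R : realType) (Z : metricType R) (p : \bar R) :
  separable Z -> 1 <= p ->
  (complete_dist (@GW_quotient R Z p) <-> complete_metric Z).
Proof.
move=> sZ p1; split.
- exact: complete_network_quotient_complete_metric.
- exact: complete_metric_complete_network_quotient.
Qed.
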